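(* Let $p\in(0,1)$ and $-1<\beta\le 0$. Then $$P\Bigl(M_\infty>0 \ \text{ and }\ S_n\sim C(p,\beta)\,M_\infty\, n^{p(\beta+1)-\beta}\ \text{ as } n\to\infty\Bigr)=1 .$$
   Context: Unidirectional elephant random walk with power law memory. For $\beta>-1$ put $\mu_n=\dfrac{\Gamma(n+\beta)}{\Gamma(n)\Gamma(\beta+1)}$, $n\in\mathbb{N}=\{1,2,\dots\}$. Let $\{\beta_{n+1}:n\in\mathbb{N}\}$ be independent random variables with $P(\beta_{n+1}=k)=\dfrac{\beta+1}{n}\cdot\dfrac{\mu_k}{\mu_{n+1}}$ for $1\le k\le n$ and $0$ otherwise (these sum to $1$ since $\sum_{\ell=1}^n\mu_\ell=\frac{n}{\beta+1}\mu_{n+1}$). Put $X_1\equiv 1$ and, for $n\ge1$, $X_{n+1}=X_{\beta_{n+1}}$ with probability $p$ and $X_{n+1}=0$ with probability $1-p$ (the choices at different times being independent of each other and of the $\beta_{n+1}$'s). Let $S_0=0$ and $S_n=\sum_{k=1}^n X_k$. Let $\Sigma_n=\sum_{k=1}^n\mu_kX_k$, and for $\gamma>-1$ let $c_n(\gamma)=\dfrac{\Gamma(n+\gamma)}{\Gamma(n)\Gamma(\gamma+1)}$. The process $M_n=\Sigma_n/c_n(p(\beta+1))$ is a non-negative martingale, and $M_\infty=\lim_{n\to\infty}M_n$, which exists almost surely. The constant is $C(p,\beta)=\dfrac{1}{p(\beta+1)-\beta}\cdot\dfrac{\Gamma(\beta+1)}{\Gamma(p(\beta+1))}$. The notation $a_n\sim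 b_n$ means $a_n/b_n\to1$ as $n\to\infty$. *)

(* Defs.v *)
From HB Require Import structures.
From mathcomp Require Import all_boot all_order all_algebra finmap.
From mathcomp Require Import all_classical all_reals all_analysis.

Set Implicit Arguments.
Unset Strict Implicit.
Unset Printing Implicit Defensive.

Import Order.TTheory GRing.Theory Num.Theory numFieldNormedType.Exports.
Local Open Scope classical_set_scope.
Local Open Scope ring_scope.

(* Euler's integral; it is finite for x > 0 only, and every argument below is
   positive as soon as n >= 1 and g > -1. *)
Definition Gamma (R : realType) (x : R) : R :=
  \int[@lebesgue_measure R]_(t in `]0, +oo[) (t `^ (x - 1) * expR (- t)).

Definition cn (R : realType) (g : R) (n : nat) : R :=
  Gamma (n%:R + g) / (Gamma n%:R * Gamma (g + 1)).

Definition mu (R : realType) (beta : R) (n : nat) : R := cn beta n.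

Definition Cst (R : realType) (p beta : R) : R :=
  1 / (p * (beta + 1) - beta) * (Gamma (beta + 1) / Gamma (p * (beta + 1))).

Definition sigma_of d d' (T : measurableType d) (U : measurableType d')
    (f : T -> U) : set (set T) :=
  [set f @^-1` B | B in measurable].

Definition mutually_independent d (T : measurableType d) (R : realType)
    (P : probability T R) (I : choiceType) (D : set I)
    (F : I -> set (set T)) : Prop :=
  forall (J : {fset I}) (A : I -> set T),
    [set` J] `<=` D -> (forall i, i \in J -> F i (A i)) ->
    P (\bigcap_(i in [set` J]) A i) = (\prod_(i <- J) P (A i))%E.

(* The variables beta_n and the choices e_n, n >= 2, form one independent
   family, indexed by nat + nat. *)
Definition independent_steps d (T : measurableType d) (R : realType)
    (P : probability T R) (b : nat -> T -> nat) (e : nat -> T -> bool) : Prop :=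
  mutually_independent P
    [set i : nat + nat | match i with inl n | inr n => (2 <= n)%N end]
    (fun i => match i with
              | inl n => sigma_of (b n)
              | inr n => sigma_of (e n)
              end).

Section Walk.
Variables (R : realType) (T : Type) (X : nat -> T -> R).

Definition walk (n : nat) (w : T) : R := \sum_(1 <= k < n.+1) X k w.

Definition Sigma (beta : R) (n : nat) (w : T) : R :=
  \sum_(1 <= k < n.+1) mu beta k * X k w.

Definition Mn (p beta : R) (n : nat) (w : T) : R :=
  Sigma beta n w / cn (p * (beta + 1)) n.

(* limn is 0 where the sequence diverges, so 0 < Minf p beta w also says that
   the limit exists at w. *)
Definition Minf (p beta : R) (w : T) : R := limn (fun n => Mn p beta n w).

End Walk.

(* Meant for b n != 0 eventually; a n / b n is 0 where b n = 0. *)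
Definition sim (R : realType) (a b : nat -> R) : Prop :=
  (fun n => a n / b n) @ \oo --> (1 : R).

(* Main.v *)
Require Import Defs.
From HB Require Import structures.
From mathcomp Require Import all_boot all_order all_algebra finmap.
From mathcomp Require Import all_classical all_reals all_analysis.
From mathcomp Require Import measurable_realfun ftc zify ring lra.

Set Implicit Arguments.
Unset Strict Implicit.
Unset Printing Implicit Defensive.

Import Order.TTheory GRing.Theory Num.Theory numFieldNormedType.Exports.
Local Open Scope classical_set_scope.
Local Open Scope ring_scope.

(** Let a = p (beta + 1), a number of (0, 1); write v_n for mu_n, c_n for
    c_n(a), Sigma_n for the sum of the v_k X_k with k <= n, and M_n for
    Sigma_n / c_n. Given the first n steps, X_{n+1} = 1 has conditional
    probability a Sigma_n / (n v_{n+1}). The law of (X_1, ..., X_n) is thus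
    given by a finite recursion, carried by the operator [expect] and tied to
    the probability space by [law_hist_event]; all moment estimates are
    computations with [expect].

    Convergence. M is a martingale, and for fixed m the process
    (M_n - M_m)^2 + (v_n / c_n) M_n is a supermartingale in n >= m
    ([condexp_sqdev_le]), so that E (M_n - M_m)^2 <= v_m / c_m, which is of
    order m^(beta - a). Along n_j = (j + 1)^q with q large, Chebyshev's
    inequality and the Borel-Cantelli lemma give
    M_{n_{j+1}} - M_{n_j} < 1 / ((j + 1) (j + 2)) for all large j
    ([ae_blocks]); then M_{n_j} + 1 / (j + 1) is eventually nonincreasing and
    M_{n_j} converges. Sigma is monotone and c_{n_{j+1}} / c_{n_j} tends to 1,
    so the whole sequence M_n converges to the same limit
    ([cvg_from_blocks]).

    Positivity. Since beta <= 0, the weights satisfy v_n <= 1 <= Sigma_n, and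
    this makes sqrt (c_n / (Sigma_n - 3/4)) a nonnegative supermartingale
    ([condexp_invroot_le]) of mean at most 2. Hence P (M_n <= t^-2) <= 2 / t
    uniformly in n, and the limit of M_n vanishes with probability 0
    ([ae_not_vanishing]).

    Growth of the walk. On a path with M_n -> L > 0 the rest is
    deterministic. With t_n = c_n / v_n, summation by parts gives
    S_n = M_n t_n + beta / (a - beta) * (sum over k < n of
    M_k (t_{k+1} - t_k)) ([abel_walk]), because c_k (1 / v_{k+1} - 1 / v_k) is a constant
    multiple of t_{k+1} - t_k. A weighted Cesaro argument then
    yields S_n / t_n -> L a / (a - beta) ([walk_asymptotics]), and
    t_n ~ Gamma(beta + 1) / Gamma(a + 1) n^(a - beta) follows from Wendel's
    inequalities for the Gamma function. *)

(** * The Gamma function *)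

Section GammaFunction.
Context {R : realType}.
Implicit Types (x s t u v l g : R) (n k : nat).

Let leb := @lebesgue_measure R.

Definition gker x t : R := t `^ (x - 1) * expR (- t).

(** Extended-real form of Euler's integral, on which the recursion can be
    proved before finiteness is known. *)
Definition gammae x : \bar R := (\int[leb]_(t in `]0%R, +oo[) (gker x t)%:E)%E.

Lemma GammaE x : Gamma x = fine (gammae x).
Proof. by []. Qed.

Lemma gker_ge0 x t : 0 <= gker x t.
Proof. by rewrite mulr_ge0 ?powR_ge0 ?expR_ge0. Qed.

Lemma measurable_gker x (D : set (measurableTypeR R)) :
  measurable D -> measurable_fun D (fun t => (gker x t)%:E).
Proof.
move=> mD; apply/measurable_EFinP/measurable_funM.
  exact: (measurable_funTS (@measurable_powR R (x - 1))).
apply: measurable_funTS; apply: measurableT_comp => //; exact: measurable_expR.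
Qed.

Lemma gammae_ge0 x : (0 <= gammae x)%E.
Proof. by apply: integral_ge0 => t _; rewrite lee_fin gker_ge0. Qed.

Lemma is_derive_expRN t : is_derive t (1:R) (fun t : R => - expR (- t)) (expR (- t)).
Proof.
apply: is_derive_eq; rewrite /GRing.scale/=; by ring.
Qed.

Lemma continuous_expRN : continuous (fun t : R => - expR (- t)).
Proof.
move=> t; apply: differentiable_continuous; apply/derivable1_diffP.
by have := is_derive_expRN t; case.
Qed.

Lemma within_continuous_powR y u v : 0 < u ->
  {within `[u, v], continuous (fun t : R => t `^ y)}.
Proof.
move=> u0; apply: derivable_within_continuous => t /itvP ht.
by apply: derivable_powR; rewrite in_itv/= andbT (lt_le_trans u0)// ht.
Qed.

Lemma within_continuousM (A : set R) (f g : R -> R) :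
  {within A, continuous f} -> {within A, continuous g} ->
  {within A, continuous (fun t => f t * g t)}.
Proof.
move=> cf cg; apply/subspace_continuousP => t At; apply: cvgM.
  by move/subspace_continuousP : cf; exact.
by move/subspace_continuousP : cg; exact.
Qed.

Lemma integral_gker_parts x u v : 0 < u -> u < v ->
  (\int[leb]_(t in `[u, v]) (gker (x + 1) t)%:E =
   (u `^ x * expR (- u) - v `^ x * expR (- v))%:E +
   x%:E * \int[leb]_(t in `[u, v]) (gker x t)%:E)%E.
Proof.
move=> u0 uv.
have v0 := lt_trans u0 uv.
have gt0 t : t \in `]u, v[ -> 0 < t by move=> /itvP ht; rewrite (lt_trans u0)// ht.
have ck : {within `[u, v], continuous (fun t => t `^ (x - 1) * expR (- t))}.
  apply: within_continuousM; first exact: within_continuous_powR.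
  apply: continuous_subspaceT => t.
  apply: continuous_comp; last exact: continuous_expR.
  exact: (@continuousN _ R^o).
have E : (\int[leb]_(t in `[u, v]) (x * t `^ (x - 1) * - expR (- t))%:E =
          - (x%:E * \int[leb]_(t in `[u, v]) (gker x t)%:E))%E.
  have ik : leb.-integrable `[u, v] (EFin \o gker x).
    by apply: continuous_compact_integrable => //; exact: segment_compact.
  rewrite -muleN -integralN/=; last first.
    by apply: fin_num_adde_defr; apply: integrable_fin_num => //; exact: integrable_funepos.
  rewrite -integralZl//; last exact: (integrableN ik).
  apply: eq_integral => t _; rewrite -EFinM; congr _%:E.
  by rewrite /gker; ring.
have := @integration_by_parts R (fun t => t `^ x) (fun t => - expR (- t))
  (fun t => x * t `^ (x - 1)) (fun t => expR (- t)) u v uv.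
rewrite {1}/gker addrK E => ->.
- rewrite oppeK; congr (_%:E + _)%E; by ring.
- apply: within_continuousM; last exact: within_continuous_powR.
  by apply: continuous_subspaceT => t; exact: cvg_cst.
- have cF t : 0 < t -> {for t, continuous (fun t : R => t `^ x)}.
    move=> t0; apply: differentiable_continuous; apply/derivable1_diffP.
    by apply: derivable_powR; rewrite in_itv/= andbT.
  split.
  + by move=> t /gt0 t0; apply: derivable_powR; rewrite in_itv/= andbT.
  + by apply/cvg_at_right_filter/cF.
  + by apply/cvg_at_left_filter/cF.
- by move=> t /gt0 t0; rewrite powR_derive1 ?in_itv/= ?andbT.
- apply: continuous_subspaceT => t.
  apply: continuous_comp; last exact: continuous_expR.
  exact: (@continuousN _ R^o).
- split.
  + by move=> t _; have := is_derive_expRN t; case.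
  + by apply/cvg_at_right_filter/continuous_expRN.
  + by apply/cvg_at_left_filter/continuous_expRN.
- move=> t _; rewrite derive1E; by have := is_derive_expRN t; case.
Qed.

Lemma cvg_powRn_pinfty (y : R) : 0 < y -> (n%:R : R) `^ y @[n --> \oo] --> +oo.
Proof.
move=> y0; apply/cvgryPge => A; near=> n.
have [A0|A0] := leP A 0; first by rewrite (le_trans A0) ?powR_ge0.
have -> : A = (A `^ y^-1) `^ y.
  by rewrite -powRrM mulVf ?gt_eqF// powRr1// ltW.
apply: ge0_ler_powR; rewrite ?nnegrE ?powR_ge0//; first exact: ltW.
by near: n; exact: nbhs_infty_ger.
Unshelve. all: by end_near. Qed.

(** From exp v >= v^(k+1) / (k+1)!. *)
Lemma powR_expRN_le (x v : R) k : x <= k%:R -> 1 <= v ->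
  v `^ x * expR (- v) <= k.+1`!%:R / v.
Proof.
move=> xk v1; have v0 : 0 < v by rewrite (lt_le_trans _ v1).
rewrite expRN ler_pdivrMr ?expR_gt0// mulrAC ler_pdivlMr//.
rewrite (@le_trans _ _ (v ^+ k.+1))//.
  rewrite exprSr ler_pM2r// -powR_mulrn ?(ltW v0)//; exact: ler_powR.
have f0 : 0 < k.+1`!%:R :> R by rewrite ltr0n fact_gt0.
have : v ^+ k.+1 / k.+1`!%:R <= expR v.
  by rewrite (le_trans _ (expR_ge1Dxn k (ltW v0)))// lerDr.
by rewrite ler_pdivrMr// mulrC.
Qed.

(* The intervals [1 / (n + 2), n + 2] exhaust ]0, +oo[; the shift by 2 keeps
   their two ends distinct. *)
Let bnd n : R := n.+2%:R.

Let bnd_gt1 n : 1 < bnd n.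
Proof. by rewrite /bnd ltr1n. Qed.

Let cvg_bndV : (bnd n)^-1 @[n --> \oo] --> 0.
Proof.
have := @cvg_harmonic R; rewrite -(cvg_shiftn 1).
by under eq_cvg do rewrite /harmonic/= addn1.
Qed.

Lemma gker_boundary_cvg0 x : 0 < x ->
  (bnd n)^-1 `^ x * expR (- (bnd n)^-1) - (bnd n) `^ x * expR (- bnd n)
    @[n --> \oo] --> 0.
Proof.
move=> x0; rewrite -[X in _ --> X](subr0 0); apply: cvgB.
  apply: (@squeeze_cvgr _ _ _ _ (cst 0) (fun n => (bnd n `^ x)^-1)); last 2 first.
  - exact: cvg_cst.
  - apply/gtr0_cvgV0; first by near=> n; rewrite powR_gt0// (lt_trans _ (bnd_gt1 n)).
    by have := cvg_powRn_pinfty x0; rewrite -(cvg_shiftn 2); under eq_cvg do rewrite /= addn2.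
  near=> n; rewrite mulr_ge0 ?powR_ge0 ?expR_ge0//=.
  have b0 : 0 < bnd n by rewrite (lt_trans _ (bnd_gt1 n)).
  rewrite -powRN -powR_inv1 ?(ltW b0)// -powRrM mulN1r ler_piMr ?powR_ge0//.
  by rewrite -expR0 ler_expR oppr_le0 powR_ge0.
set k := (Num.truncn x).+1.
apply: (@squeeze_cvgr _ _ _ _ (cst 0) (fun n => k.+1`!%:R * (bnd n)^-1)); last 2 first.
- exact: cvg_cst.
- by rewrite -[X in _ --> X](mulr0 (k.+1`!%:R)); apply: cvgMr.
near=> n; rewrite mulr_ge0 ?powR_ge0 ?expR_ge0//=.
apply: powR_expRN_le; last exact: ltW.
by rewrite ltW// truncnS_gt.
Unshelve. all: by end_near. Qed.

Let bitv n : set (measurableTypeR R) := `[(bnd n)^-1, bnd n]%classic.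

Let bigcup_bitv : \bigcup_n bitv n = `]0%R, +oo[%classic.
Proof.
apply/seteqP; split=> [t [n _]|t]; rewrite /bitv/= !in_itv/= ?andbT.
  by move=> /andP[+ _]; apply: lt_le_trans; rewrite invr_gt0 (lt_trans _ (bnd_gt1 n)).
move=> t0; exists (Num.truncn (t + t^-1)) => //=.
set n := Num.truncn _.
have h : t + t^-1 <= bnd n.
  rewrite (le_trans (ltW (truncnS_gt _)))//.
  by rewrite ler_nat.
have b0 : 0 < bnd n by rewrite (lt_trans _ (bnd_gt1 n)).
rewrite in_itv/=; apply/andP; split.
  by rewrite -[leRHS]invrK lef_pV2 ?posrE ?invr_gt0// (le_trans _ h)// lerDr ltW.
by rewrite (le_trans _ h)// lerDl invr_ge0 ltW.
Qed.

Let cvg_bitv x :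
  (\int[leb]_(t in bitv n) (gker x t)%:E)%E @[n --> \oo] --> gammae x.
Proof.
rewrite /gammae -bigcup_bitv.
apply: (@ge0_nondecreasing_set_cvg_integral _ _ _ bitv (fun t => (gker x t)%:E) leb).
- apply/nondecreasing_seqP => n; apply/subsetPset => t.
  rewrite /bitv/= !in_itv/= => /andP[h1 h2].
  have b0 : 0 < bnd n by rewrite (lt_trans _ (bnd_gt1 n)).
  have h : bnd n <= bnd n.+1 by rewrite ler_nat.
  rewrite (le_trans h2 h) andbT (le_trans _ h1)// lef_pV2 ?posrE//.
- by move=> n; rewrite /bitv.
- by move=> n; apply: measurable_gker; rewrite /bitv.
- by move=> n t _; rewrite lee_fin gker_ge0.
Qed.

(** Integrate by parts on the exhausting intervals: the boundary terms vanish
    in the limit and both integrals converge monotonically. *)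
Lemma gammaeS x : 0 < x -> gammae (x + 1) = (x%:E * gammae x)%E.
Proof.
move=> x0.
have h1 := @cvg_bitv (x + 1).
have h2 : (\int[leb]_(t in bitv n) (gker (x + 1) t)%:E)%E @[n --> \oo] -->
  (0%:E + x%:E * gammae x)%E.
  have bV n : 0 < (bnd n)^-1 by rewrite invr_gt0 (lt_trans _ (bnd_gt1 n)).
  have bVb n : (bnd n)^-1 < bnd n.
    by rewrite (@lt_trans _ _ 1)// invf_lt1// (lt_trans _ (bnd_gt1 n)).
  under eq_cvg do rewrite (integral_gker_parts x (bV _) (bVb _)).
  apply: cvgeD; [exact: fin_num_adde_defr| |].
    apply: cvg_EFin; first exact: nearW.
    exact: gker_boundary_cvg0.
  by apply: cvgeZl => //; exact: cvg_bitv.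
by have := cvg_unique _ h1 h2; rewrite add0e; apply.
Qed.

Lemma gammae1 : gammae 1 = 1%E.
Proof.
have := @ge0_continuous_FTC2y R (fun t => expR (- t)) (fun t => - expR (- t)) 0 0.
move=> H.
rewrite /gammae integral_itv_obnd_cbnd; last exact: measurable_gker.
transitivity (\int[leb]_(t in `[0%R, +oo[) (expR (- t))%:E)%E.
  by apply: eq_integral => t _; rewrite /gker subrr powRr0 mul1r.
rewrite H; first by rewrite oppr0 expR0 EFinN oppeK add0e.
- by move=> t _; rewrite expR_ge0.
- apply: continuous_subspaceT => t.
  apply: continuous_comp; last exact: continuous_expR.
  exact: (@continuousN _ R^o).
- by rewrite -[X in _ --> X]oppr0; apply: cvgN; exact: cvgr_expR.
- by move=> t _; have := is_derive_expRN t; case.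
- by apply/cvg_at_right_filter; exact: continuous_expRN.
- by move=> t _; rewrite derive1E; have := is_derive_expRN t; case.
Qed.

Lemma gammae_nat_fin n : gammae n.+1%:R \is a fin_num.
Proof.
elim: n => [|n IH]; first by rewrite gammae1.
by rewrite -natr1 gammaeS ?ltr0n// fin_numM.
Qed.

(** t^x <= 1 + t^n for a natural n >= x bounds Gamma(x + 1) by the finite
    values at integers; the recursion then goes down to Gamma(x). *)
Lemma gammae_fin x : 0 < x -> gammae x \is a fin_num.
Proof.
move=> x0.
have : gammae (x + 1) \is a fin_num.
  set n := (Num.truncn x).+1.
  rewrite ge0_fin_numE ?gammae_ge0//.
  apply: (@le_lt_trans _ _ (gammae 1 + gammae n.+1%:R)%E); last first.
    by rewrite gammae1 ltey_eq fin_numD gammae_nat_fin.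
  rewrite /gammae -ge0_integralD//=; last 4 first.
  - by move=> t _; rewrite lee_fin gker_ge0.
  - exact: measurable_gker.
  - by move=> t _; rewrite lee_fin gker_ge0.
  - exact: measurable_gker.
  apply: ge0_le_integral => //=.
  - by move=> t _; rewrite lee_fin gker_ge0.
  - exact: measurable_gker.
  - by apply: emeasurable_funD; exact: measurable_gker.
  move=> t; rewrite in_itv/= andbT => t0; rewrite -EFinD lee_fin /gker -mulrDl.
  rewrite ler_wpM2r ?expR_ge0// addrK subrr powRr0 -natr1 addrK powR_mulrn ?(ltW t0)//.
  have [t1|t1] := leP t 1.
    rewrite -[leLHS]addr0 lerD ?exprn_ge0 ?(ltW t0)//.
    by rewrite -(powRr0 t); apply: ger_powR; rewrite ?t0 ?t1// ltW.
  rewrite -[leLHS]add0r lerD// -powR_mulrn ?(ltW t0)//.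
  by apply: ler_powR; rewrite ?(ltW t1)// ltW// truncnS_gt.
rewrite gammaeS// => h.
have -> : gammae x = ((x^-1)%:E * (x%:E * gammae x))%E.
  by rewrite muleA -EFinM mulVf ?gt_eqF// mul1e.
by rewrite fin_numM.
Qed.

Lemma EFin_Gamma x : 0 < x -> (Gamma x)%:E = gammae x.
Proof. by move=> x0; rewrite GammaE fineK// gammae_fin. Qed.

Lemma Gamma1 : Gamma (1 : R) = 1.
Proof. by rewrite GammaE gammae1. Qed.

Lemma GammaS x : 0 < x -> Gamma (x + 1) = x * Gamma x.
Proof. by move=> x0; rewrite !GammaE gammaeS// fineM// gammae_fin. Qed.

Local Opaque Gamma.

Lemma powR_invl x s : 0 <= x -> x^-1 `^ s = (x `^ s)^-1.
Proof. by move=> x0; rewrite -powR_inv1// -powRrM mulN1r powRN. Qed.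

(** The concave function y^s lies below its tangent at 1; this is Young's
    inequality. *)
Lemma powR_tangent s y : 0 < s < 1 -> 0 <= y -> y `^ s <= 1 - s + s * y.
Proof.
move=> /andP[s0 s1] y0.
have h1 : 0 < 1 - s by rewrite subr_gt0.
have := @conjugate_powR R (y `^ s) 1 s^-1 (1 - s)^-1.
rewrite powR_ge0 !invr_gt0 s0 h1 !invrK addrC subrK => /(_ isT ler01 isT isT erefl).
rewrite mulr1 -powRrM mulfV ?gt_eqF// powRr1// powR1 mul1r; lra.
Qed.

(** Wendel's inequality. In the integral, t^s is bounded by its tangent at
    t = x, and the linear function of t that results is integrated with
    Gamma(x + 1) = x Gamma(x). *)
Lemma Gamma_addr_le x s : 0 < x -> 0 < s < 1 -> Gamma (x + s) <= x `^ s * Gamma x.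
Proof.
move=> x0 s01; have /andP[s0 s1] := s01.
have xs0 : 0 < x + s by rewrite addr_gt0.
have x10 : 0 < x + 1 by rewrite addr_gt0.
have h1 : 0 <= 1 - s by rewrite subr_ge0 ltW.
pose A := (1 - s) * x `^ s; pose B := s * x `^ (s - 1).
have A0 : 0 <= A by rewrite mulr_ge0// powR_ge0.
have B0 : 0 <= B by rewrite mulr_ge0 ?powR_ge0// ltW.
suff H : ((Gamma (x + s))%:E <= A%:E * (Gamma x)%:E + B%:E * (Gamma (x + 1))%:E)%E.
  have : Gamma (x + s) <= A * Gamma x + B * Gamma (x + 1).
    by move: H; rewrite -!EFinM -EFinD lee_fin.
  rewrite GammaS// /A /B => /le_trans; apply.
  have -> : x `^ s = x * x `^ (s - 1) by rewrite mulr_powRB1// ltW.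
  by rewrite le_eqVlt; apply/predU1P; left; ring.
rewrite (EFin_Gamma x0) (EFin_Gamma x10) (EFin_Gamma xs0).
rewrite /gammae -!ge0_integralZl//=; last 4 first.
- exact: measurable_gker.
- by move=> t _; rewrite lee_fin gker_ge0.
- exact: measurable_gker.
- by move=> t _; rewrite lee_fin gker_ge0.
rewrite -ge0_integralD//=; last 4 first.
- by move=> t _; rewrite -EFinM lee_fin mulr_ge0// gker_ge0.
- by apply: measurable_funeM; exact: measurable_gker.
- by move=> t _; rewrite -EFinM lee_fin mulr_ge0// gker_ge0.
- by apply: measurable_funeM; exact: measurable_gker.
apply: ge0_le_integral => //=.
- by move=> t _; rewrite lee_fin gker_ge0.
- exact: measurable_gker.
- by apply: emeasurable_funD; apply: measurable_funeM; exact: measurable_gker.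
move=> t; rewrite in_itv/= andbT => t0; rewrite -!EFinM -EFinD lee_fin /gker.
rewrite !mulrA -mulrDl ler_wpM2r ?expR_ge0// addrK.
have -> : x + s - 1 = x - 1 + s by ring.
rewrite powRD; last by rewrite (gt_eqF t0) implybT.
have -> : t `^ x = t `^ (x - 1) * t by rewrite mulrC mulr_powRB1// ltW.
have := @powR_tangent s (t / x) s01 (divr_ge0 (ltW t0) (ltW x0)).
rewrite powRM ?invr_ge0 ?(ltW t0) ?(ltW x0)//.
rewrite (powR_invl _ (ltW x0)) ler_pdivrMr ?powR_gt0// => h.
have -> : A * t `^ (x - 1) + B * (t `^ (x - 1) * t) =
   t `^ (x - 1) * ((1 - s + s * (t / x)) * x `^ s).
  rewrite /A /B; have -> : x `^ s = x * x `^ (s - 1) by rewrite mulr_powRB1// ltW.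
  by field; rewrite gt_eqF.
by rewrite ler_wpM2l// powR_ge0.
Qed.

(** On (0, 1], Wendel's inequality compares Gamma(x) with Gamma(1) = 1; larger
    arguments are reached by the recursion. *)
Lemma Gamma_gt0 x : 0 < x -> 0 < Gamma x.
Proof.
have H n : forall x, 0 < x <= n.+1%:R -> 0 < Gamma x.
  elim: n => [|n IH] y /andP[y0 yn].
    have [->|y1] := eqVneq y 1; first by rewrite Gamma1.
    have s01 : 0 < 1 - y < 1 by rewrite subr_gt0 lt_neqAle y1 yn/= ltrBlDr ltrDl.
    have := Gamma_addr_le y0 s01; rewrite addrC subrK Gamma1 => h.
    by rewrite -(pmulr_rgt0 _ (powR_gt0 (1 - y) y0)) (lt_le_trans _ h).
  have [y1|y1] := leP y 1; first by apply: IH; rewrite y0 (le_trans y1)// ler1n.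
  have y10 : 0 < y - 1 by rewrite subr_gt0.
  rewrite -(subrK 1 y) GammaS// mulr_gt0// IH// y10/=.
  by rewrite lerBlDr natr1.
move=> x0; apply: (H (Num.truncn x)); rewrite x0 ltW//; exact: truncnS_gt.
Qed.

Lemma cvg_addr_pinfty g : (n%:R + g : R) @[n --> \oo] --> +oo.
Proof.
apply/cvgryPge => A; near=> n; rewrite -lerBlDr.
by near: n; exact: nbhs_infty_ger.
Unshelve. all: by end_near. Qed.

Lemma cvg_natr_addr_ratio g : n%:R / (n%:R + g) @[n --> \oo] --> (1 : R).
Proof.
have h : (n%:R + g)^-1 @[n --> \oo] --> (0 : R).
  apply/gtr0_cvgV0; last exact: cvg_addr_pinfty.
  near=> n; rewrite -ltrBlDr sub0r; near: n; exact: nbhs_infty_gtr.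
have : 1 - g * (n%:R + g)^-1 @[n --> \oo] --> 1 - g * 0.
  by apply: cvgB; [exact: cvg_cst|apply: cvgMr].
rewrite mulr0 subr0; apply: cvg_trans; apply: near_eq_cvg; near=> n.
have ng : 0 < n%:R + g.
  by rewrite -ltrBlDr sub0r; near: n; exact: nbhs_infty_gtr.
by field; rewrite gt_eqF.
Unshelve. all: by end_near. Qed.

(** Wendel's inequality at (n, g) gives the upper bound 1, and at
    (n + g, 1 - g) the lower bound (n / (n + g))^(1 - g) >= n / (n + g). *)
Lemma Gamma_ratio_cvg g : 0 < g <= 1 ->
  Gamma (n%:R + g) / (n%:R `^ g * Gamma n%:R) @[n --> \oo] --> (1 : R).
Proof.
move=> /andP[g0]; rewrite le_eqVlt => /predU1P[->|g1].
  apply: cvg_near_cst; near=> n.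
  have n0 : 0 < n%:R :> R by rewrite ltr0n; near: n; exact: nbhs_infty_gt.
  by rewrite GammaS// powRr1 ?ltW// mulfV// gt_eqF// mulr_gt0// Gamma_gt0.
apply: (@squeeze_cvgr _ _ _ _ (fun n => n%:R / (n%:R + g)) (cst 1)); last 2 first.
- exact: cvg_natr_addr_ratio.
- exact: cvg_cst.
near=> n.
have n0 : 0 < n%:R :> R by rewrite ltr0n; near: n; exact: nbhs_infty_gt.
have ng0 : 0 < n%:R + g by rewrite addr_gt0.
have d0 : 0 < n%:R `^ g * Gamma n%:R by rewrite mulr_gt0 ?powR_gt0 ?Gamma_gt0.
apply/andP; split; last first.
  by rewrite /= ler_pdivrMr// mul1r Gamma_addr_le// g0.
have h : n%:R * Gamma n%:R <= (n%:R + g) `^ (1 - g) * Gamma (n%:R + g).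
  have e : n%:R + 1 = n%:R + g + (1 - g) by ring.
  rewrite -(GammaS n0) e.
  by rewrite Gamma_addr_le// subr_gt0 g1/= ltrBlDr ltrDl.
have q : 0 < n%:R / (n%:R + g) <= 1.
  by rewrite divr_gt0//= ler_pdivrMr// mul1r lerDl ltW.
have q1 : n%:R / (n%:R + g) <= n%:R `^ (1 - g) / (n%:R + g) `^ (1 - g).
  apply: (le_trans (ger1_powR (r := 1 - g) q _)); first by rewrite gerBl ltW.
  by rewrite powRM ?invr_ge0 ?(ltW n0) ?(ltW ng0)// (powR_invl _ (ltW ng0)).
apply: (le_trans q1).
rewrite ler_pdivrMr ?powR_gt0// mulrAC ler_pdivlMr//.
have -> : n%:R `^ (1 - g) * (n%:R `^ g * Gamma n%:R) = n%:R * Gamma n%:R.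
  rewrite mulrA -powRD ?subrK ?powRr1 ?(ltW n0)//.
  by rewrite (gt_eqF n0) implybT.
by rewrite [leRHS]mulrC.
Unshelve. all: by end_near. Qed.

Lemma cn1 g : -1 < g -> cn g 1 = 1.
Proof.
move=> g1; rewrite /cn Gamma1 mul1r addrC mulfV// gt_eqF// Gamma_gt0//; lra.
Qed.

Lemma cnS g n : -1 < g -> (0 < n)%N -> cn g n.+1 = cn g n * ((n%:R + g) / n%:R).
Proof.
move=> g1 n0.
have n1 : 1 <= n%:R :> R by rewrite ler1n.
have ng0 : 0 < n%:R + g by lra.
have nR0 : 0 < n%:R :> R by lra.
have g0 : 0 < g + 1 by lra.
have e : n.+1%:R + g = n%:R + g + 1 by rewrite -natr1; ring.
rewrite /cn e -natr1 (GammaS ng0) (GammaS nR0).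
have := gt_eqF (Gamma_gt0 g0); have := gt_eqF (Gamma_gt0 nR0).
move: (Gamma (n%:R + g)) (Gamma n%:R) (Gamma (g + 1)) => A B C h1 h2.
by field; rewrite h1 h2 gt_eqF.
Qed.

(** For g <= 0 the argument n + g + 1 is used instead of n + g. *)
Lemma cn_cvg g : -1 < g <= 1 ->
  cn g n / n%:R `^ g @[n --> \oo] --> (Gamma (g + 1))^-1.
Proof.
move=> /andP[g1 gle].
have G0 : 0 < Gamma (g + 1) by rewrite Gamma_gt0//; lra.
have [g0|g0] := ltP 0 g.
  have h1 : Gamma (n%:R + g) / (n%:R `^ g * Gamma n%:R) @[n --> \oo] --> (1 : R).
    by apply: Gamma_ratio_cvg; rewrite g0.
  have : Gamma (n%:R + g) / (n%:R `^ g * Gamma n%:R) * (Gamma (g + 1))^-1 @[n --> \oo] -->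
      1 * (Gamma (g + 1))^-1.
    by apply: cvgM => //; exact: cvg_cst.
  rewrite mul1r; apply: cvg_trans; apply: near_eq_cvg; near=> n.
  have n0 : 0 < n%:R :> R by rewrite ltr0n; near: n; exact: nbhs_infty_gt.
  have := gt_eqF G0; have := gt_eqF (Gamma_gt0 n0); have := gt_eqF (powR_gt0 g n0).
  rewrite /cn /=.
  move: (Gamma (n%:R + g)) (Gamma n%:R) (Gamma (g + 1)) (n%:R `^ g) => A B C D h2 h3 h4.
  by field; rewrite h2 h3 h4.
have h1 : Gamma (n%:R + (g + 1)) / (n%:R `^ (g + 1) * Gamma n%:R) @[n --> \oo] --> (1 : R).
  by apply: Gamma_ratio_cvg; lra.
have : Gamma (n%:R + (g + 1)) / (n%:R `^ (g + 1) * Gamma n%:R) * (n%:R / (n%:R + g)) *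
    (Gamma (g + 1))^-1 @[n --> \oo] --> 1 * 1 * (Gamma (g + 1))^-1.
  apply: cvgM; last exact: cvg_cst.
  by apply: cvgM => //; exact: cvg_natr_addr_ratio.
rewrite !mul1r; apply: cvg_trans; apply: near_eq_cvg; near=> n.
have n1 : 1 < n%:R :> R by rewrite ltr1n; near: n; exact: nbhs_infty_gt.
have n0 : 0 < n%:R :> R by lra.
have ng0 : 0 < n%:R + g by lra.
have e : n%:R `^ (g + 1) = n%:R `^ g * n%:R.
  by rewrite powRD ?powRr1 ?(ltW n0)// (gt_eqF n0) implybT.
rewrite /cn /= addrA (GammaS ng0) e.
have := gt_eqF G0; have := gt_eqF (Gamma_gt0 n0); have := gt_eqF (powR_gt0 g n0).
have := gt_eqF n0; have := gt_eqF ng0.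
move: (Gamma (n%:R + g)) (Gamma n%:R) (Gamma (g + 1)) (n%:R `^ g) => A B C D.
move=> h2 h3 h4 h5 h6; field.
by rewrite h2 h3 h4 h5 h6.
Unshelve. all: by end_near. Qed.

End GammaFunction.

(** * Weighted means and block subsequences *)

Section DeterministicPart.
Context {R : realType}.
Implicit Types (n m j q : nat).

(** Cesaro's theorem for means weighted by the increments of t: the terms
    before a rank N contribute a constant, which t n outgrows, and the others
    are within eps / 2 of L. *)
Lemma weighted_cesaro (x t : nat -> R) (L : R) :
  (forall n, (0 < n)%N -> 0 < t n /\ t n <= t n.+1) ->
  t @ \oo --> +oo -> x @ \oo --> L ->
  (\sum_(1 <= k < n) x k * (t k.+1 - t k)) / t n @[n --> \oo] --> L.
Proof.
move=> ht ty xL.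
have tV : (t n)^-1 @[n --> \oo] --> (0 : R).
  apply/gtr0_cvgV0 => //; near=> n.
  by have [] // := ht n _; near: n; exact: nbhs_infty_gt.
suff h : (\sum_(1 <= k < n) (x k - L) * (t k.+1 - t k)) / t n @[n --> \oo] --> (0 : R).
  have : (\sum_(1 <= k < n) (x k - L) * (t k.+1 - t k)) / t n + (L - L * t 1%N * (t n)^-1)
      @[n --> \oo] --> 0 + (L - L * t 1%N * 0).
    by apply: cvgD => //; apply: cvgB; [exact: cvg_cst|exact: cvgMr].
  rewrite mulr0 subr0 add0r; apply: cvg_trans; apply: near_eq_cvg; near=> n.
  have n0 : (0 < n)%N by near: n; exact: nbhs_infty_gt.
  have [tn _] := ht n n0.
  have -> : \sum_(1 <= k < n) x k * (t k.+1 - t k) =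
    \sum_(1 <= k < n) (x k - L) * (t k.+1 - t k) + L * (t n - t 1%N).
    rewrite -telescope_sumr// mulr_sumr -big_split/=.
    by apply: eq_bigr => k _; ring.
  by field; rewrite gt_eqF.
apply/cvgr0Pnorm_le => eps eps0.
have [N _ HN] : \forall n \near \oo, `|x n - L| <= eps / 2.
  have /cvgrPdist_le/(_ (eps / 2)) := xL; rewrite divr_gt0// => /(_ isT).
  by apply: filterS => n; rewrite distrC.
pose K := \sum_(1 <= k < N.+1) `|(x k - L) * (t k.+1 - t k)|.
have K0 : 0 <= K by apply: sumr_ge0.
have bound n : (N < n)%N ->
    `|\sum_(1 <= k < n) (x k - L) * (t k.+1 - t k)| <= K + eps / 2 * t n.
  elim: n => // n IH; rewrite ltnS leq_eqVlt => /predU1P[<-|Nn].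
    rewrite (le_trans (ler_norm_sum _ _ _))// lerDl mulr_ge0//.
      by rewrite ltW// divr_gt0.
    by have [/ltW] := ht N.+1 isT.
  have n0 : (0 < n)%N by apply: leq_ltn_trans Nn.
  have [tn tnS] := ht n n0.
  rewrite big_nat_recr//= (le_trans (ler_normD _ _))//.
  have h1 := IH Nn.
  have h2 : `|(x n - L) * (t n.+1 - t n)| <= eps / 2 * (t n.+1 - t n).
    rewrite normrM [X in _ * X]ger0_norm ?subr_ge0//.
    by rewrite ler_wpM2r ?subr_ge0// HN//= ltnW.
  rewrite (le_trans (lerD h1 h2))//; lra.
near=> n.
have Nn : (N < n)%N by near: n; exact: nbhs_infty_gt.
have [tn _] := ht n (leq_ltn_trans (leq0n _) Nn).
rewrite normrM normfV [X in _ / X]gtr0_norm// ler_pdivrMr//.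
rewrite (le_trans (bound n Nn))//.
have : 2 * K / eps <= t n.
  by near: n; have /cvgryPge := ty; exact.
rewrite ler_pdivrMr//; lra.
Unshelve. all: by end_near. Qed.

Lemma block_index (nj : nat -> nat) J n : (forall j, (nj j < nj j.+1)%N) ->
  (nj J <= n)%N -> exists2 j, (J <= j)%N & (nj j <= n < nj j.+1)%N.
Proof.
move=> hnj; elim: n => [|n IH].
  rewrite leqn0 => /eqP h; exists J => //.
  by rewrite h /=; have := hnj J; rewrite h.
rewrite leq_eqVlt => /predU1P[<-|]; first by exists J => //; rewrite leqnn hnj.
rewrite ltnS => /IH[j Jj /andP[h1 h2]].
have [h|h] := ltnP n.+1 (nj j.+1).
  by exists j => //; rewrite h (leq_trans h1).
by exists j.+1; [exact: leqW|rewrite h (leq_ltn_trans h2)].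
Qed.

(** A quotient of monotone quantities inside a block, compared with its values
    at the two ends of the block. *)
Lemma ratio_sandwich (s1 s2 s3 c1 c2 c3 r : R) :
  0 <= s1 <= s2 -> s2 <= s3 -> 0 < c1 <= c2 -> c2 <= c3 -> c3 / c1 <= r ->
  s1 / c1 * r^-1 <= s2 / c2 /\ s2 / c2 <= s3 / c3 * r.
Proof.
move=> /andP[s10 s12] s23 /andP[c10 c12] c23 hr.
have c20 := lt_le_trans c10 c12; have c30 := lt_le_trans c20 c23.
have r0 : 0 < r by rewrite (lt_le_trans _ hr)// divr_gt0.
have s20 := le_trans s10 s12; have s30 := le_trans s20 s23.
have hr' : c3 <= r * c1 by rewrite -ler_pdivrMr.
split.
  apply: (@le_trans _ _ (s1 / c3)).
    rewrite -mulrA ler_wpM2l// -invfM lef_pV2 ?posrE ?mulr_gt0//.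
    by rewrite mulrC.
  by apply: ler_pM; rewrite ?invr_ge0 ?(ltW c30)// lef_pV2.
apply: (@le_trans _ _ (s3 / c1)).
  by apply: ler_pM; rewrite ?invr_ge0 ?(ltW c20)// lef_pV2.
have -> : s3 / c3 * r = s3 * (r / c3) by ring.
by rewrite ler_wpM2l// ler_pdivlMr// mulrC.
Qed.

Definition block q j : nat := (j.+1 ^ q)%N.

Lemma block_gt0 q j : (0 < block q j)%N.
Proof. by rewrite expn_gt0. Qed.

Lemma block_lt q j : (0 < q)%N -> (block q j < block q j.+1)%N.
Proof. by move=> q0; rewrite ltn_exp2r. Qed.

Lemma cvg_block_ratio q :
  ((block q j.+1)%:R / (block q j)%:R : R) @[j --> \oo] --> (1 : R).
Proof.
have h : ((1 + harmonic j) ^+ q : R) @[j --> \oo] --> (1 + 0 : R) ^+ q.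
  apply: (@continuous_cvg _ _ _ _ _ _ (fun x : R => x ^+ q)).
    exact: exprn_continuous.
  by apply: cvgD; [exact: cvg_cst|exact: cvg_harmonic].
rewrite addr0 expr1n in h.
apply: cvg_trans h; apply: near_eq_cvg; near=> j.
rewrite /block !natrX -expr_div_n; congr (_ ^+ _).
have : (0 : R) < j.+1%:R by rewrite ltr0n.
rewrite /harmonic/= -(natr1 j.+1); move: (j.+1%:R : R) => y y0.
by field; rewrite gt_eqF.
Unshelve. all: by end_near. Qed.

End DeterministicPart.

(** * Sequences of rising-factorial ratios *)

(** All that the probabilistic part uses of the sequence cn g, for which
    k = 1 / Gamma(g + 1). *)
Definition rising_ratio (R : realType) (g k : R) (c : nat -> R) : Prop :=
  [/\ c 1%N = 1,
      forall n, (0 < n)%N -> c n.+1 = c n * ((n%:R + g) / n%:R),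
      c n / n%:R `^ g @[n --> \oo] --> k & 0 < k].

Lemma cn_rising_ratio (R : realType) (g : R) : -1 < g <= 1 ->
  rising_ratio g (Gamma (g + 1))^-1 (cn g).
Proof.
move=> /andP[g1 gle]; split.
- exact: cn1.
- by move=> n n0; exact: cnS.
- by apply: cn_cvg; rewrite g1.
- by rewrite invr_gt0 Gamma_gt0// -ltrBlDr sub0r.
Qed.

Section RisingRatioTheory.
Context {R : realType} {g k : R} {c : nat -> R}.
Hypothesis hc : rising_ratio g k c.
Implicit Types n m : nat.

Lemma rising_ratio1 : c 1%N = 1.
Proof. by case: hc. Qed.

Lemma rising_ratioS n : (0 < n)%N -> c n.+1 = c n * ((n%:R + g) / n%:R).
Proof. by case: hc => _ + _ _; apply. Qed.

Lemma rising_ratio_gt0 n : -1 < g -> (0 < n)%N -> 0 < c n.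
Proof.
move=> g1; elim: n => // -[_ _|n IH _]; first by rewrite rising_ratio1.
have n0 : 0 < n.+1%:R :> R by rewrite ltr0n.
have n1 : 1 <= n.+1%:R :> R by rewrite ler1n.
rewrite rising_ratioS// mulr_gt0 ?IH// divr_gt0//; lra.
Qed.

Lemma rising_ratio_le n m : 0 <= g -> (0 < n <= m)%N -> c n <= c m.
Proof.
move=> g0 /andP[n0]; elim: m => [|m IH]; first by case: n n0.
rewrite leq_eqVlt => /predU1P[->//|nm].
have m0 : (0 < m)%N by rewrite (leq_trans n0).
have g1 : -1 < g by exact: lt_le_trans (ltrN10 R) g0.
have m1 : 1 <= m%:R :> R by rewrite ler1n.
rewrite (le_trans (IH nm))// rising_ratioS//.
rewrite ler_peMr ?(ltW (rising_ratio_gt0 g1 _))// ler_pdivlMr; lra.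
Qed.

(** For g <= 1 the sequence c n / n is nonincreasing. *)
Lemma rising_ratio_quotient n m : -1 < g <= 1 -> (0 < n <= m)%N ->
  c m / c n <= m%:R / n%:R.
Proof.
move=> /andP[g1 gle] /andP[n0]; have cn0 := rising_ratio_gt0 g1 n0.
have n1 : 1 <= n%:R :> R by rewrite ler1n.
elim: m => [|m IH]; first by case: n n0 n1 cn0.
rewrite leq_eqVlt => /predU1P[<-|nm].
  by rewrite !mulfV// gt_eqF//; lra.
have m0 : (0 < m)%N by rewrite (leq_trans n0).
have m1 : 1 <= m%:R :> R by rewrite ler1n.
have -> : c m.+1 / c n = (c m / c n) * ((m%:R + g) / m%:R).
  by rewrite rising_ratioS//; ring.
have -> : m.+1%:R / n%:R = (m%:R / n%:R) * ((m%:R + 1) / m%:R) :> R.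
  by rewrite -natr1; field; rewrite !gt_eqF//; lra.
apply: ler_pM.
- by rewrite divr_ge0// ltW// rising_ratio_gt0.
- by rewrite divr_ge0//; lra.
- exact: IH.
- by rewrite ler_pM2r ?invr_gt0; lra.
Qed.

End RisingRatioTheory.

(** * The walk along one path *)

Section PathwiseAsymptotics.
Context {R : realType}.
Variables (beta a kv kc : R) (v c : nat -> R).
Implicit Types (n m j q : nat).
Hypotheses (b1 : -1 < beta) (b0 : beta <= 0) (a0 : 0 < a) (a_lt1 : a < 1).
Hypotheses (hv : rising_ratio beta kv v) (hc : rising_ratio a kc c).

Local Ltac blra := have := b1; have := b0; have := a0; lra.

Let c_gt0 n : (0 < n)%N -> 0 < c n.
Proof. exact: (rising_ratio_gt0 hc (lt_trans (ltrN10 R) a0)). Qed.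

Let v_gt0 n : (0 < n)%N -> 0 < v n.
Proof. exact: (rising_ratio_gt0 hv b1). Qed.

Definition growth n : R := c n / v n.

Lemma growth_gt0 n : (0 < n)%N -> 0 < growth n.
Proof. by move=> n0; rewrite divr_gt0 ?v_gt0 ?c_gt0. Qed.

Lemma growthS n : (0 < n)%N -> growth n.+1 = growth n * ((n%:R + a) / (n%:R + beta)).
Proof.
move=> n0; have n1 : 1 <= n%:R :> R by rewrite ler1n.
rewrite /growth (rising_ratioS hv n0) (rising_ratioS hc n0); field.
by rewrite !gt_eqF ?v_gt0//; blra.
Qed.

Lemma growth_increment n : (0 < n)%N ->
  growth n.+1 - growth n = growth n * ((a - beta) / (n%:R + beta)).
Proof.
move=> n0; have n1 : 1 <= n%:R :> R by rewrite ler1n.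
by rewrite growthS//; field; rewrite gt_eqF//; blra.
Qed.

Lemma growth_leS n : (0 < n)%N -> growth n <= growth n.+1.
Proof.
move=> n0; have n1 : 1 <= n%:R :> R by rewrite ler1n.
rewrite -subr_ge0 growth_increment// mulr_ge0 ?(ltW (growth_gt0 _))// divr_ge0//; blra.
Qed.

Lemma cvg_growth : growth n / n%:R `^ (a - beta) @[n --> \oo] --> kc / kv.
Proof.
case: hv => _ _ h2 kv0; case: hc => _ _ h1 kc0.
have : c n / n%:R `^ a * (v n / n%:R `^ beta)^-1 @[n --> \oo] --> kc * kv^-1.
  by apply: cvgM => //; apply: cvgV => //; rewrite gt_eqF.
apply: cvg_trans; apply: near_eq_cvg; near=> n.
have n0 : (0 < n)%N by near: n; exact: nbhs_infty_gt.
have nR0 : 0 < n%:R :> R by rewrite ltr0n.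
rewrite /= /growth powRB; last by rewrite (gt_eqF nR0) implybT.
have := gt_eqF (v_gt0 n0); have := gt_eqF (c_gt0 n0).
have := gt_eqF (powR_gt0 a nR0); have := gt_eqF (powR_gt0 beta nR0).
move: (v n) (c n) (n%:R `^ a) (n%:R `^ beta) => A B C D h3 h4 h5 h6.
by field; rewrite ?h3 ?h4 ?h5 ?h6.
Unshelve. all: by end_near. Qed.

Lemma growth_ge_powR : \forall n \near \oo, kc / kv / 2 * n%:R `^ (a - beta) <= growth n.
Proof.
have k0 : 0 < kc / kv by rewrite divr_gt0//; [case: hc|case: hv].
have /cvgrPdist_le/(_ (kc / kv / 2)) := cvg_growth; rewrite divr_gt0// => /(_ isT) h.
near=> n.
have nR0 : 0 < n%:R :> R by rewrite ltr0n; near: n; exact: nbhs_infty_gt.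
rewrite -ler_pdivlMr ?powR_gt0//.
have : `|kc / kv - growth n / n%:R `^ (a - beta)| <= kc / kv / 2 by near: n.
rewrite ler_norml; lra.
Unshelve. all: by end_near. Qed.

Lemma growth_cvgy : growth @ \oo --> +oo.
Proof.
have k0 : 0 < kc / kv by rewrite divr_gt0//; [case: hc|case: hv].
have ab : 0 < a - beta by blra.
have /cvgryPge pw := cvg_powRn_pinfty ab.
apply/cvgryPge => A; near=> n.
have h : kc / kv / 2 * n%:R `^ (a - beta) <= growth n by near: n; exact: growth_ge_powR.
apply: le_trans h; rewrite mulrC -ler_pdivrMr; last by rewrite divr_gt0.
by near: n; exact: pw.
Unshelve. all: by end_near. Qed.

Section OnePath.
Variable x : nat -> R.
Let S n := \sum_(1 <= k < n.+1) x k.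
Let Sg n := \sum_(1 <= k < n.+1) v k * x k.
Let M n := Sg n / c n.

(** Summation by parts of x k = (v k * x k) / v k. The increments of
    1 / v k times c k are (- beta) / (a - beta) times those of growth, which
    turns the remainder into a mean of M weighted by the increments of
    growth. *)
Lemma abel_walk n : (0 < n)%N ->
  S n = M n * growth n + beta / (a - beta) * \sum_(1 <= k < n) M k * (growth k.+1 - growth k).
Proof.
have ab : (a - beta == 0) = false by rewrite gt_eqF//; blra.
elim: n => // -[_ _|n IH _].
  rewrite big_geq// mulr0 addr0 /S /M /Sg /growth !big_nat1 (rising_ratio1 hv) (rising_ratio1 hc).
  by field.
rewrite /S big_nat_recr//= -/(S n.+1) IH//.
rewrite [in RHS]big_nat_recr//= growth_increment//.
set Z := \sum_(_ <= _ < _) _; move: Z => Z.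
rewrite [in RHS]/M /Sg [in RHS]big_nat_recr//= -/(Sg n.+1) /M /growth.
rewrite (rising_ratioS hc (isT : (0 < n.+1)%N))
  (rising_ratioS hv (isT : (0 < n.+1)%N)).
have := gt_eqF (@v_gt0 n.+1 isT); have := gt_eqF (@c_gt0 n.+1 isT).
have : 0 < n.+1%:R + a by rewrite addr_gt0// ltr0n.
have : 0 < n.+1%:R + beta.
  have : 1 <= n.+1%:R :> R by rewrite ler1n.
  blra.
have : 0 < n.+1%:R :> R by rewrite ltr0n.
move: (Sg n.+1) (x n.+2) (v n.+1) (c n.+1) (n.+1%:R : R) => A B C D E.
move=> /gt_eqF h1 /gt_eqF h2 /gt_eqF h3 h4 h5.
by field; rewrite ?h1 ?h2 ?h3 ?h4 ?h5 ?ab.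
Qed.

Lemma walk_asymptotics (L : R) : 0 < L -> M @ \oo --> L ->
  sim S (fun n => a / (a - beta) * (kc / kv) * L * n%:R `^ (a - beta)).
Proof.
move=> L0 ML.
have h1 := weighted_cesaro
  (fun n (n0 : (0 < n)%N) => conj (growth_gt0 n0) (growth_leS n0)) growth_cvgy ML.
have k0 : 0 < kc / kv by rewrite divr_gt0//; [case: hc|case: hv].
pose C : R := a / (a - beta) * (kc / kv) * L.
have ab : 0 < a - beta by blra.
have C0 : 0 < C by rewrite /C mulr_gt0// mulr_gt0// divr_gt0.
have : (M n + beta / (a - beta) * ((\sum_(1 <= k < n) M k * (growth k.+1 - growth k)) / growth n))
    * (growth n / n%:R `^ (a - beta)) * C^-1 @[n --> \oo] -->
   (L + beta / (a - beta) * L) * (kc / kv) * C^-1.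
  apply: cvgM; last exact: cvg_cst.
  apply: cvgM; last exact: cvg_growth.
  by apply: cvgD => //; exact: cvgMr.
have -> : (L + beta / (a - beta) * L) * (kc / kv) * C^-1 = 1.
  move: k0 C0; rewrite /C; move: (kc / kv) => k k0 _.
  have := gt_eqF k0; have := gt_eqF a0; have := gt_eqF L0; have := gt_eqF ab.
  by move=> h2 h3 h4 h5; field; rewrite ?h2 ?h3 ?h4 ?h5.
apply: cvg_trans; apply: near_eq_cvg; near=> n.
have n0 : (0 < n)%N by near: n; exact: nbhs_infty_gt.
have nR0 : 0 < n%:R :> R by rewrite ltr0n.
rewrite /= -/C abel_walk//.
have := gt_eqF (growth_gt0 n0); have := gt_eqF (powR_gt0 (a - beta) nR0); have := gt_eqF C0.
have := gt_eqF ab.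
clear C0; move: (growth n) (n%:R `^ (a - beta)) C (M n) => A B D E h2 h3 h4 h5.
by field; rewrite ?h2 ?h3 ?h4 ?h5.
Unshelve. all: by end_near. Qed.

(** Inside a block the numerator Sg is monotone, and c varies by a factor that
    tends to 1. *)
Lemma cvg_from_blocks q (L : R) : (0 < q)%N -> (forall k, (0 < k)%N -> 0 <= x k) ->
  M (block q j) @[j --> \oo] --> L -> M @ \oo --> L.
Proof.
move=> q0 x0 ML.
have x0' k : (0 < k)%N -> 0 <= v k * x k.
  by move=> k0; rewrite mulr_ge0 ?x0// ltW// v_gt0.
have Sg0 n : 0 <= Sg n.
  by rewrite /Sg big_nat_cond sumr_ge0// => k /andP[/andP[k0 _] _]; exact: x0'.
have SgS n m : (n <= m)%N -> Sg n <= Sg m.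
  move=> nm; rewrite /Sg (@big_cat_nat _ _ _ n.+1 1 m.+1)//= lerDl.
  rewrite big_nat_cond sumr_ge0// => k /andP[/andP[k0 _] _].
  by rewrite x0'// (leq_ltn_trans _ k0).
pose r j : R := (block q j.+1)%:R / (block q j)%:R.
have r0 j : 0 < r j by rewrite divr_gt0// ltr0n block_gt0.
have rV : (r j)^-1 @[j --> \oo] --> (1 : R).
  by rewrite -[X in _ --> X]invr1; apply: cvgV; [exact: oner_neq0|exact: cvg_block_ratio].
have lo : M (block q j) * (r j)^-1 @[j --> \oo] --> L.
  by rewrite -[X in _ --> X]mulr1; exact: cvgM.
have hi : M (block q j.+1) * r j @[j --> \oo] --> L.
  rewrite -[X in _ --> X]mulr1; apply: cvgM; last exact: cvg_block_ratio.
  by move: ML; rewrite -cvg_shiftS.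
apply/cvgrPdist_le => eps eps0.
have [J _ HJ] : \forall j \near \oo,
   L - eps <= M (block q j) * (r j)^-1 /\ M (block q j.+1) * r j <= L + eps.
  have /cvgrPdist_le/(_ _ eps0) := lo; have /cvgrPdist_le/(_ _ eps0) := hi.
  apply: filterS2 => j; rewrite !ler_distlC => /andP[_ h1] /andP[h2 _]; split => //.
near=> n.
have : (block q J <= n)%N by near: n; exact: nbhs_infty_ge.
move=> /(block_index (fun j => block_lt j q0))[j Jj /andP[h1 h2]].
have [lo1 hi1] := HJ j Jj.
have nj0 := block_gt0 q j; have n0 := leq_trans nj0 h1.
have nS0 := block_gt0 q j.+1.
have c1 : 0 < c (block q j) by exact: c_gt0.
have c2 : 0 < c n by exact: c_gt0.
have c3 : 0 < c (block q j.+1) by exact: c_gt0.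
have nn : (0 < block q j <= block q j.+1)%N by rewrite nj0 ltnW// block_lt.
have [lo2 hi2] : M (block q j) * (r j)^-1 <= M n /\ M n <= M (block q j.+1) * r j.
  apply: ratio_sandwich.
  - by rewrite Sg0 SgS.
  - by rewrite SgS// ltnW.
  - by rewrite c1/= (rising_ratio_le hc (ltW a0))// nj0.
  - by rewrite (rising_ratio_le hc (ltW a0))// n0 ltnW.
  - apply: (rising_ratio_quotient hc); last exact: nn.
    by rewrite (lt_trans (ltrN10 R) a0) ltW.
by rewrite ler_distlC (le_trans lo1)//= (le_trans hi2).
Unshelve. all: by end_near. Qed.

End OnePath.
End PathwiseAsymptotics.

(** * The finite law of the walk *)

Section Law.
Context {R : realType}.
Variables (v : nat -> R) (a : R).
Implicit Types (n m k : nat) (s : nat -> bool) (g h : (nat -> bool) -> R).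

(** A history up to time n is the indicator of the times k <= n with X k = 1,
    extended by false; [initial] is the history at time 1. *)
Definition upd s n (x : bool) : nat -> bool := fun k => if k == n then x else s k.

Definition initial : nat -> bool := fun k => k == 1%N.

Definition weight n s : R := \sum_(1 <= k < n.+1) v k * (s k)%:R.

(** Conditional probability of X (n + 1) = 1 when the history at time n is s. *)
Definition success_prob n s : R := a * weight n s / (n%:R * v n.+1).

(** Conditional expectation, given the history s at time n, of g applied to
    the history at time n + 1. *)
Definition condexp n g s : R :=
  success_prob n s * g (upd s n.+1 true) + (1 - success_prob n s) * g (upd s n.+1 false).

(** Expectation of g applied to the history at time n + 1; the shift accounts
    for the start at time 1. *)
Fixpoint expect n g : R := if n is n'.+1 then expect n' (condexp n'.+1 g) else g initial.

Definition valid n s : Prop :=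
  s 1%N /\ forall k, s k -> (0 < k <= n.+1)%N.

Lemma valid_initial : valid 0 initial.
Proof. by split=> // k /eqP ->. Qed.

Lemma valid_upd n s x : valid n s -> valid n.+1 (upd s n.+2 x).
Proof.
move=> [s1 sk]; split=> // k; rewrite /upd; case: eqP => [->|_ /sk]; first by rewrite leqnn.
by case/andP => -> /= /leq_trans; apply.
Qed.

Lemma weight_upd n m s x : (n < m)%N -> weight n (upd s m x) = weight n s.
Proof.
move=> nm; rewrite /weight !big_nat; apply: eq_bigr => k /andP[_ kn].
by rewrite /upd ltn_eqF// (leq_trans kn).
Qed.

Lemma weight_updS n s x : weight n.+1 (upd s n.+1 x) = weight n s + v n.+1 * x%:R.
Proof.
by rewrite /weight big_nat_recr//= -!/(weight _ _) weight_upd// /upd eqxx.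
Qed.

Lemma eq_expect n g h : g =1 h -> expect n g = expect n h.
Proof.
elim: n g h => [|n IH] g h gh /=; first exact: gh.
by apply: IH => s; rewrite /condexp !gh.
Qed.

Lemma expectD n g h : expect n (fun s => g s + h s) = expect n g + expect n h.
Proof.
elim: n g h => //= n IH g h; rewrite -IH; apply: eq_expect => s; rewrite /condexp; ring.
Qed.

Lemma expectZ n (l : R) g : expect n (fun s => l * g s) = l * expect n g.
Proof.
elim: n g => //= n IH g; rewrite -IH; apply: eq_expect => s; rewrite /condexp; ring.
Qed.

Lemma expect_sum n m (F : nat -> (nat -> bool) -> R) :
  expect n (fun s => \sum_(i < m) F i s) = \sum_(i < m) expect n (F i).
Proof.
elim: m => [|m IH].
  rewrite big_ord0 -[RHS](mul0r (expect n (fun=> 0))) -expectZ.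
  by apply: eq_expect => s; rewrite big_ord0 mulr0.
rewrite big_ord_recr/= -IH -expectD; apply: eq_expect => s; by rewrite big_ord_recr.
Qed.

Hypothesis v_gt0 : forall n, (0 < n)%N -> 0 < v n.
(* The conditional probabilities are at most 1. *)
Hypothesis q_le1 : forall n, (0 < n)%N ->
  a * \sum_(1 <= k < n.+1) v k <= n%:R * v n.+1.
Hypothesis a_gt0 : 0 < a.

Lemma weight_ge0 n s : 0 <= weight n s.
Proof.
rewrite /weight big_nat_cond; apply: sumr_ge0 => k /andP[/andP[k0 _] _].
by rewrite mulr_ge0// ltW// v_gt0.
Qed.

Lemma success_prob_itv n s : (0 < n)%N -> 0 <= success_prob n s <= 1.
Proof.
move=> n0; have nR0 : 0 < n%:R :> R by rewrite ltr0n.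
have d0 : 0 < n%:R * v n.+1 by rewrite mulr_gt0// v_gt0.
rewrite divr_ge0 ?(ltW d0) ?mulr_ge0 ?weight_ge0 ?(ltW a_gt0)//=.
rewrite ler_pdivrMr// mul1r (le_trans _ (q_le1 n0))// ler_pM2l//.
rewrite /weight !big_nat; apply: ler_sum => k /andP[k0 _].
by rewrite ler_piMr ?(ltW (v_gt0 _))//; case: (s k).
Qed.

Lemma expect_le n g h : (forall s, valid n s -> g s <= h s) -> expect n g <= expect n h.
Proof.
elim: n g h => [|n IH] g h gh /=; first exact/gh/valid_initial.
apply: IH => s vs; rewrite /condexp.
have /andP[q0 q1] := success_prob_itv s (isT : (0 < n.+1)%N).
by apply: lerD; apply: ler_wpM2l; rewrite ?subr_ge0//; apply/gh/valid_upd.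
Qed.

Lemma expect_markov n g (A : (nat -> bool) -> bool) (t : R) : 0 < t ->
  (forall s, valid n s -> 0 <= g s) ->
  (forall s, valid n s -> A s -> t <= g s) ->
  expect n (fun s => (A s)%:R) <= expect n g / t.
Proof.
move=> t0 g0 At; rewrite mulrC -expectZ; apply: expect_le => s vs.
rewrite mulrC; case: (boolP (A s)) => [As|_] /=.
  by rewrite ler_pdivlMr// mul1r At.
by rewrite divr_ge0 ?g0// ltW.
Qed.

End Law.

(** * The law on the probability space *)

Section Link.
Context {R : realType} (d : measure_display) (T : measurableType d).
Variables (P : probability T R) (p gam : R) (v : nat -> R).
Variables (b : nat -> {RV P >-> nat}) (e : nat -> {RV P >-> bool}).
Hypothesis hb : forall n k : nat, (1 <= n)%N ->
  P (b n.+1 @^-1` [set k]) =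
    (if (1 <= k <= n)%N then gam / n%:R * (v k / v n.+1) else 0)%:E.
Hypothesis he : forall n : nat, (1 <= n)%N -> P (e n.+1 @^-1` [set true]) = p%:E.
Hypothesis hindep : independent_steps P b e.

Let a := p * gam.

(** History at time n + 1 read off from the choices. A value of b outside the
    range 1, ..., n + 1 points to a time where the history is false, so the
    history is meaningful at every point. *)
Fixpoint hist (n : nat) (w : T) : nat -> bool :=
  if n is n'.+1 then
    let s := hist n' w in upd s n'.+2 (e n'.+2 w && s (b n'.+2 w))
  else initial.

Lemma valid_hist n w : valid n (hist n w).
Proof. by elim: n => [|n IH]; [exact: valid_initial|exact: valid_upd]. Qed.

Definition time (i : nat + nat) : nat := match i with inl n | inr n => n end.

Definition choices (i : nat + nat) : set (set T) :=
  match i with inl n => sigma_of (b n) | inr n => sigma_of (e n) end.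

(** Intersections of finitely many events, each about one choice made after
    time n. *)
Definition future n (F : set T) : Prop :=
  exists (J : {fset (nat + nat)%type}) (A : nat + nat -> set T),
    [/\ forall i, i \in J -> (n < time i)%N,
        forall i, i \in J -> choices i (A i) &
        F = \bigcap_(i in [set` J]) A i].

Lemma future_setT n : future n setT.
Proof. by exists fset0, (fun=> setT); split=> //; apply/seteqP; split. Qed.

Lemma measurable_choices i A : choices i A -> measurable A.
Proof.
by case: i => n /= [B mB <-]; rewrite -[_ @^-1` _]setTI; exact: measurable_funPT.
Qed.

Lemma future_measurable n F : future n F -> measurable F.
Proof.
move=> [J [A [_ JA ->]]]; apply: fin_bigcap_measurable => //= i Ji.
exact: (measurable_choices (JA i Ji)).
Qed.

Lemma future_le n F : future n.+1 F -> future n F.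
Proof. by move=> [J [A [Jt JA FE]]]; exists J, A; split => // i /Jt/ltnW. Qed.

(** Two choices made at time n + 1 are added to the finite family of later
    ones, and the product formula is applied to both families. *)
Lemma future_step n F k : (0 < n)%N -> future n.+1 F ->
  let G := b n.+1 @^-1` [set k] `&` (e n.+1 @^-1` [set true] `&` F) in
  future n G /\
  P G = (P (b n.+1 @^-1` [set k]) * (P (e n.+1 @^-1` [set true]) * P F))%E.
Proof.
move=> n0 [J [A [Jt JA ->]]] G.
have nl : inl n.+1 \notin J by apply/negP => /Jt /=; rewrite ltnn.
have nr : inr n.+1 \notin J by apply/negP => /Jt /=; rewrite ltnn.
pose A' i := if i == inl n.+1 then b n.+1 @^-1` [set k]
  else if i == inr n.+1 then e n.+1 @^-1` [set true] else A i.
pose J' := (inl n.+1 |` (inr n.+1 |` J))%fset.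
have A'J i : i \in J -> A' i = A i.
  move=> iJ; rewrite /A'; case: eqP => [ie|_]; first by rewrite -ie iJ in nl.
  by case: eqP => [ie|//]; rewrite -ie iJ in nr.
have t' i : i \in J' -> (n < time i)%N.
  by rewrite !in_fset1U => /or3P[/eqP->|/eqP->|/Jt/ltnW].
have c' i : i \in J' -> choices i (A' i).
  rewrite !in_fset1U => /or3P[/eqP->|/eqP->|iJ].
  - by rewrite /A' eqxx; exists [set k].
  - by rewrite /A' /= eqxx; exists [set true].
  - by rewrite A'J//; exact: JA.
have GE : G = \bigcap_(i in [set` J']) A' i.
  apply/seteqP; split => [w [/= wb [we wF]] i /=|w wF].
    rewrite !in_fset1U => /or3P[/eqP->|/eqP->|iJ].
    - by rewrite /A' eqxx.
    - by rewrite /A' /= eqxx.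
    - by rewrite A'J//; exact: wF.
  split; first by have := wF (inl n.+1); rewrite /A' eqxx; apply; rewrite /= !in_fset1U eqxx.
  split; first by have := wF (inr n.+1); rewrite /A' /= eqxx; apply;
    rewrite /= !in_fset1U eqxx orbT.
  by move=> i iJ; rewrite -A'J//; apply: wF; rewrite /= !in_fset1U iJ !orbT.
split; first by exists J', A'.
rewrite GE (hindep (J := J') (A := A')); last 2 first.
- by move=> i /= /t'; case: i => j /=; apply: leq_ltn_trans.
- by move=> i /c'; case: i.
rewrite big_fsetU1/=; last by rewrite in_fset1U negb_or nl.
rewrite big_fsetU1//= {1}/A' eqxx {1}/A' /= eqxx; congr (_ * (_ * _))%E.
rewrite (hindep (J := J) (A := A)); last 2 first.
- by move=> i /= /Jt; case: i => j /=; apply: leq_trans.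
- by move=> i /JA; case: i.
by apply: eq_big_seq => i iJ; rewrite A'J.
Qed.

Definition success n (B : (nat -> bool) -> bool) : set T :=
  [set w | B (hist n w) && (e n.+2 w && hist n w (b n.+2 w))].

Let branch n (B : (nat -> bool) -> bool) k : set T :=
  [set w | B (hist n w) && hist n w k] `&`
  (b n.+2 @^-1` [set k] `&` e n.+2 @^-1` [set true]).

Lemma successE n B : success n B = \big[setU/set0]_(k < n.+2) branch n B k.
Proof.
apply/seteqP; split => [w /and3P[Bw ew hw]|w].
  have [_ /(_ _ hw)/andP[_ bn]] := valid_hist n w.
  rewrite -bigcup_mkord; exists (b n.+2 w) => //.
  by split => //=; rewrite Bw hw.
rewrite -bigcup_mkord => -[k /= kn [/= /andP[Bw hk] [bk ek]]].
by rewrite /success/= Bw bk hk ek.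
Qed.

Lemma hist_eventS n (B : (nat -> bool) -> bool) :
  [set w | B (hist n.+1 w)] =
  success n (fun s => B (upd s n.+2 true)) `|`
  ([set w | B (upd (hist n w) n.+2 false)] `\` success n (fun s => B (upd s n.+2 false))).
Proof.
apply/seteqP; split => w; rewrite /success/=.
  by case: (e n.+2 w && hist n w (b n.+2 w)) => Bw; [left; rewrite Bw|right; rewrite andbF].
by case: (e n.+2 w && hist n w (b n.+2 w)); rewrite ?andbT ?andbF => -[]// [] // _ [].
Qed.

Lemma measurable_preim_b n k : measurable (b n @^-1` [set k]).
Proof. by rewrite -[_ @^-1` _]setTI; exact: measurable_funPT. Qed.

Lemma measurable_preim_e n : measurable (e n @^-1` [set true]).
Proof. by rewrite -[_ @^-1` _]setTI; exact: measurable_funPT. Qed.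

Lemma set_bool (c : bool) : [set _ : T | c] = if c then setT else set0.
Proof. by apply/seteqP; split => w /=; case: c. Qed.

Let measurable_branch n B k :
  (forall B' : (nat -> bool) -> bool, measurable [set w | B' (hist n w)]) -> measurable (branch n B k).
Proof.
move=> mH; apply: measurableI; first exact: (mH (fun s => B s && s k)).
by apply: measurableI; [exact: measurable_preim_b|exact: measurable_preim_e].
Qed.

Lemma measurable_hist_event n (B : (nat -> bool) -> bool) :
  measurable [set w | B (hist n w)].
Proof.
elim: n B => [|n IH] B /=.
  by rewrite set_bool; case: (B initial).
have ms B' : measurable (success n B').
  by rewrite successE; apply: bigsetU_measurable => k _; exact: measurable_branch.
rewrite hist_eventS; apply: measurableU; first exact: ms.
by apply: measurableD; [exact: (IH (fun s => B (upd s n.+2 false)))|exact: ms].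
Qed.

Lemma measurable_success n B : measurable (success n B).
Proof.
rewrite successE; apply: bigsetU_measurable => k _.
by apply: measurable_branch; exact: measurable_hist_event.
Qed.

(** By induction on n, carrying an event F of the future along: the event
    X (n + 2) = 1 splits according to the value k of b, each piece being an
    event of the past intersected with a future event, and the event
    X (n + 2) = 0 is obtained by difference. *)
Lemma law_hist n (B : (nat -> bool) -> bool) (F : set T) : future n.+1 F ->
  P ([set w | B (hist n w)] `&` F) = ((expect v a n (fun s => (B s)%:R))%:E * P F)%E.
Proof.
elim: n B F => [|n IH] B F futF /=.
  by rewrite set_bool; case: (B initial); rewrite ?setTI ?mul1e// set0I measure0 mul0e.
have mF := future_measurable futF.
have fF : P F = (fine (P F))%:E by rewrite fineK// fin_num_measure.
have law_success B' : P (success n B' `&` F) =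
    ((expect v a n (fun s => success_prob v a n.+1 s * (B' s)%:R))%:E * P F)%E.
  have -> : success n B' `&` F = \big[setU/set0]_(k < n.+2) (branch n B' k `&` F).
    by rewrite successE big_distrl.
  rewrite measure_semi_additive_ord//=; last 3 first.
  - move=> k; apply: measurableI => //; apply: measurable_branch.
    exact: measurable_hist_event.
  - apply/trivIsetP => i j _ _ ij; rewrite -subset0 => w [[[_ [/= bi _]] _] [[_ [/= bj _]] _]].
    by move: ij; rewrite -val_eqE/= -bi bj eqxx.
  - apply: bigsetU_measurable => k _; apply: measurableI => //; apply: measurable_branch.
    exact: measurable_hist_event.
  pose ck k : R := if (1 <= k <= n.+1)%N then gam / n.+1%:R * (v k / v n.+2) else 0.
  have -> : (\sum_(k < n.+2) P (branch n B' k `&` F) =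
     \sum_(k < n.+2) (expect v a n (fun s => (B' s && s k)%:R) * (ck k * (p * fine (P F))))%:E)%E.
    apply: eq_bigr => k _.
    have [futG PG] := future_step k (isT : (0 < n.+1)%N) futF.
    by rewrite /branch -!setIA (IH (fun s => B' s && s k) _ futG) PG hb// he// {1}fF -!EFinM.
  rewrite sumEFin fF -EFinM; congr _%:E.
  transitivity
    ((\sum_(k < n.+2) expect v a n (fun s => (B' s && s k)%:R * (p * ck k))) * fine (P F)).
    rewrite mulr_suml; apply: eq_bigr => k _.
    transitivity (p * ck k * expect v a n (fun s => (B' s && s k)%:R) * fine (P F)); first by ring.
    by rewrite -expectZ; congr (_ * _); apply: eq_expect => s; rewrite mulrC.
  rewrite -(expect_sum v a n n.+2 (fun k s => (B' s && s k)%:R * (p * ck k))).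
  congr (_ * _); apply: eq_expect => s.
  rewrite -(big_mkord xpredT (fun k => (B' s && s k)%:R * (p * ck k))) big_ltn//.
  rewrite {1}/ck /= !mulr0 add0r /success_prob /weight /a mulr_sumr !mulr_suml !big_nat.
  apply: eq_bigr => k kn; rewrite /ck kn; case: (B' s); case: (s k) => /=; rewrite ?mulr0 ?mul0r//.
  by rewrite !mulr1 mul1r invfM; ring.
have mS B' := measurable_success n B'.
have mH := measurable_hist_event n (fun s => B (upd s n.+2 false)).
set B1 := fun s => B (upd s n.+2 true); set B0 := fun s => B (upd s n.+2 false).
have -> : [set w | B (hist n.+1 w)] `&` F =
   (success n B1 `&` F) `|` (([set w | B0 (hist n w)] `&` F) `\` (success n B0 `&` F)).
  rewrite hist_eventS -/B1 -/B0.
  by apply/seteqP; split => w /=; tauto.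
have mSF B' : measurable (success n B' `&` F) by exact: measurableI.
have mHF : measurable ([set w | B0 (hist n w)] `&` F) by exact: measurableI.
transitivity (P (success n B1 `&` F) +
    (P ([set w | B0 (hist n w)] `&` F) - P (success n B0 `&` F)))%E.
  rewrite measureU//; last 2 first.
  - exact: measurableD.
  - rewrite -subset0 => w [[]]; rewrite /success/= => /andP[_ hw] Fw [[Bw _]].
    by rewrite Bw hw => /not_andP[].
  rewrite measureD//; last by rewrite ltey_eq fin_num_measure.
  rewrite (_ : _ `&` (success n B0 `&` F) = success n B0 `&` F)//.
  by apply/setIidPr => w [/andP[]].
rewrite (law_success B1) (law_success B0) (IH B0 F (future_le futF)) fF -!EFinM -EFinB -EFinD; congr _%:E.
rewrite -mulrBl -mulrDl; congr (_ * _).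
rewrite -[X in _ + (_ - X)]mul1r -mulNr -expectZ -!expectD; apply: eq_expect => s.
by rewrite /condexp /B0 /B1; ring.
Qed.

Lemma law_hist_event n (B : (nat -> bool) -> bool) :
  P [set w | B (hist n w)] = (expect v a n (fun s => (B s)%:R))%:E.
Proof. by have := law_hist B (future_setT n.+1); rewrite setIT probability_setT mule1. Qed.

End Link.

(** * Moment estimates *)

Section Moments.
Context {R : realType}.
Variables (beta a kv kc : R) (v c : nat -> R).
Implicit Types (n m k : nat) (s : nat -> bool).
Hypotheses (b1 : -1 < beta) (b0 : beta <= 0) (a0 : 0 < a) (a_lt1 : a < 1).
Hypothesis ab1 : a <= beta + 1.
Hypotheses (hv : rising_ratio beta kv v) (hc : rising_ratio a kc c).

Let v_pos n (n0 : (0 < n)%N) : 0 < v n := rising_ratio_gt0 hv b1 n0.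
Let c_pos n (n0 : (0 < n)%N) : 0 < c n :=
  rising_ratio_gt0 hc (lt_trans (ltrN10 R) a0) n0.

Lemma sum_weights n : (beta + 1) * \sum_(1 <= k < n.+1) v k = n%:R * v n.+1.
Proof.
have b1' := b1.
elim: n => [|n IH]; first by rewrite big_geq// mulr0 mul0r.
rewrite big_nat_recr//= mulrDr IH (rising_ratioS hv (isT : (0 < n.+1)%N)).
have n0 : 0 < n.+1%:R :> R by rewrite ltr0n.
by rewrite -(natr1 n) in n0 *; field; rewrite gt_eqF.
Qed.

Lemma weighted_sum_le n : (0 < n)%N ->
  a * \sum_(1 <= k < n.+1) v k <= n%:R * v n.+1.
Proof.
move=> n0; rewrite -sum_weights ler_wpM2r// big_nat_cond sumr_ge0// => k.
by move=> /andP[/andP[k0 _] _]; rewrite ltW// v_pos.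
Qed.

Lemma v_le1 n : (0 < n)%N -> v n <= 1.
Proof.
elim: n => // -[_ _|n IH _]; first by rewrite (rising_ratio1 hv).
rewrite (rising_ratioS hv (isT : (0 < n.+1)%N)) (le_trans _ (IH isT))//.
have n0 : 0 < n.+1%:R :> R by rewrite ltr0n.
rewrite ger_pMr ?v_pos// ler_pdivrMr// mul1r; have := b0; lra.
Qed.

Lemma weight_ge1 n s : valid n s -> 1 <= weight v n.+1 s.
Proof.
move=> [s1 _]; rewrite /weight big_ltn// s1 (rising_ratio1 hv) mulr1 lerDl.
rewrite big_nat_cond sumr_ge0// => k /andP[/andP[k0 _] _].
by rewrite mulr_ge0// ltW// v_pos// (leq_trans _ k0).
Qed.

Definition mart n s : R := weight v n s / c n.

Lemma mart_ge0 n s : (0 < n)%N -> 0 <= mart n s.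
Proof. by move=> n0; rewrite divr_ge0 ?(ltW (c_pos n0))// weight_ge0. Qed.

Lemma mart_upd n m s x : (n < m)%N -> mart n (upd s m x) = mart n s.
Proof. by move=> nm; rewrite /mart weight_upd. Qed.

Lemma condexp_mart n s : (0 < n)%N -> condexp v a n (mart n.+1) s = mart n s.
Proof.
move=> n0; rewrite /condexp /mart !weight_updS /success_prob (rising_ratioS hc n0) mulr1 mulr0 addr0.
have /gt_eqF h1 := c_pos n0; have /gt_eqF h2 := v_pos (isT : (0 < n.+1)%N).
have nR : 0 < n%:R :> R by rewrite ltr0n.
have /gt_eqF h4 : 0 < n%:R + a by rewrite addr_gt0.
have /gt_eqF h3 := nR.
move: (weight v n s) (c n) (v n.+1) (n%:R : R) h1 h2 h3 h4 {nR} => A B C D h1 h2 h3 h4.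
by field; rewrite ?h1 ?h2 ?h3 ?h4.
Qed.

Lemma expect_mart n : expect v a n (mart n.+1) = 1.
Proof.
elim: n => [|n IH] /=.
  by rewrite /mart /weight big_nat1 (rising_ratio1 hv) (rising_ratio1 hc) /= mulr1 divr1.
by rewrite -[RHS]IH; apply: eq_expect => s; rewrite condexp_mart.
Qed.

(** The second term compensates the conditional variance of the increments. *)
Definition sqdev m n s : R := (mart n s - mart m s) ^+ 2 + (growth v c n)^-1 * mart n s.

(** With q the success probability and u = 1 / growth, the conditional
    variance of the increment is at most q v(n+1)^2 / c(n+1)^2, which does not
    exceed (u(n) - u(n+1)) M(n) since beta <= 0. *)
Lemma condexp_sqdev_le m n s : (0 < m <= n)%N -> condexp v a n (sqdev m n.+1) s <= sqdev m n s.
Proof.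
move=> /andP[m0 mn]; have n0 : (0 < n)%N by exact: leq_trans mn.
have S0 : 0 <= weight v n s by exact: weight_ge0.
have /andP[q0 q1] := success_prob_itv v_pos weighted_sum_le a0 s n0.
have nR : 1 <= n%:R :> R by rewrite ler1n.
rewrite /condexp /sqdev !(@mart_upd m)// /mart !weight_updS /growth (rising_ratioS hc n0) mulr1 mulr0 addr0.
have hq : success_prob v a n s = a * weight v n s / (n%:R * v n.+1) by [].
have vE := rising_ratioS hv n0.
have cp := c_pos n0; have vp := v_pos n0; have vp' := v_pos (isT : (0 < n.+1)%N).
move: (success_prob v a n s) (weight v n s) (weight v m s / c m) hq q0 q1 S0 => q A x hq q0 q1 A0.
move: (v n.+1) vE vp' hq => v' vE vp' hq.
move: (c n) (v n) (n%:R : R) cp vp nR vE hq => C V N C0 V0 N1 vE hq.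
have b1' := b1; have b0' := b0; have a0' := a0.
have N0 : 0 < N by lra.
have Na0 : 0 < N + a by lra.
have Nb0 : 0 < N + beta by lra.
have hN := gt_eqF N0; have hNa := gt_eqF Na0; have hNb := gt_eqF Nb0.
have hV := gt_eqF V0; have hC := gt_eqF C0; have hv' := gt_eqF vp'.
set C' := C * ((N + a) / N).
have C'0 : 0 < C' by rewrite mulr_gt0// divr_gt0.
have hC' := gt_eqF C'0.
have mean : (A + q * v') / C' = A / C.
  by rewrite hq /C'; field; rewrite ?hN ?hNa ?hC ?hv'.
(* Bounding 1 - q by 1 leaves a comparison of a / (N + a) with
   (a - beta) / (N + beta). *)
have var : q * (1 - q) * v' ^+ 2 / C' ^+ 2 <= ((C / V)^-1 - (C' / v')^-1) * (A / C).
  apply: (@le_trans _ _ (a * A * v' / (N * C' ^+ 2))).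
    have -> : a * A * v' / (N * C' ^+ 2) = q * v' ^+ 2 / C' ^+ 2.
      by rewrite hq; field; rewrite ?hN ?hC' ?hv'.
    rewrite ler_wpM2r ?invr_ge0 ?sqr_ge0// ler_wpM2r ?sqr_ge0//.
    by rewrite ler_piMr// gerBl.
  have -> : ((C / V)^-1 - (C' / v')^-1) * (A / C) =
      (A * v' / (C * C')) * ((a - beta) / (N + beta)).
    by rewrite vE /C'; field; rewrite ?hN ?hNa ?hNb ?hC ?hV.
  have -> : a * A * v' / (N * C' ^+ 2) = (A * v' / (C * C')) * (a / (N + a)).
    by rewrite /C'; field; rewrite ?hN ?hNa ?hC.
  apply: ler_wpM2l.
    by apply: divr_ge0; apply: mulr_ge0 => //; exact: ltW.
  rewrite ler_pdivrMr// mulrAC ler_pdivlMr//.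
  have h1 : beta * a <= 0 by rewrite mulr_le0_ge0// ltW.
  have h2 : beta * N <= 0 by rewrite mulr_le0_ge0// ltW.
  have h3 : 0 <= a * a by rewrite mulr_ge0 ?ltW.
  lra.
rewrite -mean in var *.
have -> : q * (((A + v') / C' - x) ^+ 2 + (C' / v')^-1 * ((A + v') / C')) +
   (1 - q) * ((A / C' - x) ^+ 2 + (C' / v')^-1 * (A / C')) =
   ((A + q * v') / C' - x) ^+ 2 + q * (1 - q) * v' ^+ 2 / C' ^+ 2 +
   (C' / v')^-1 * ((A + q * v') / C').
  by field; rewrite ?hC' ?hv'.
rewrite -addrA lerD2l -lerBrDr -mulrBl; exact: var.
Qed.

Lemma expect_sqdev m n : (m <= n)%N ->
  expect v a n (fun s => (mart n.+1 s - mart m.+1 s) ^+ 2) <= (growth v c m.+1)^-1.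
Proof.
move=> mn; have tp k := growth_gt0 b1 a0 hv hc (isT : (0 < k.+1)%N).
apply: (@le_trans _ _ (expect v a n (sqdev m.+1 n.+1))).
  apply: (expect_le v_pos weighted_sum_le a0) => s _.
  by rewrite lerDl mulr_ge0 ?mart_ge0// invr_ge0 ltW.
apply: (@le_trans _ _ (expect v a m (sqdev m.+1 m.+1))); last first.
  rewrite -[leRHS]mulr1 -(expect_mart m) -expectZ le_eqVlt; apply/predU1P; left.
  by apply: eq_expect => s; rewrite /sqdev subrr expr0n/= add0r.
elim: n mn => [|n IH]; first by rewrite leqn0 => /eqP ->.
rewrite leq_eqVlt => /predU1P[->//|mn]; apply: le_trans (IH mn) => /=.
apply: (expect_le v_pos weighted_sum_le a0) => s _.
by apply: condexp_sqdev_le.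
Qed.

(** An inverse square root of M. With the shift 3/4 it is a supermartingale
    also when beta = 0, where the weights stay equal to 1. *)
Definition invroot n s : R := Num.sqrt (c n / (weight v n s - 3 / 4)).

(** With S = y + 3/4 the inequality clears to
    w (3 S (1 - w) + w^2 - 3 w / 4) >= 0, which holds for S >= 1 and
    0 < w <= 1. *)
Lemma shrink_sqrt (y w : R) : 1 / 4 <= y -> 0 < w <= 1 ->
  y / (y + w) <= (1 - w / (2 * (y + 3 / 4))) ^+ 2.
Proof.
move=> y4 /andP[w0 w1].
have yw : 0 < y + w by lra.
have S0 : 0 < 2 * (y + 3 / 4) by lra.
rewrite ler_pdivrMr//.
have -> : (1 - w / (2 * (y + 3 / 4))) ^+ 2 * (y + w) =
   (2 * (y + 3 / 4) - w) ^+ 2 * (y + w) / (2 * (y + 3 / 4)) ^+ 2.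
  by field; rewrite gt_eqF//; lra.
rewrite ler_pdivlMr ?exprn_gt0//.
have h1 : 0 <= (y - 1 / 4) * (1 - w) by rewrite mulr_ge0// subr_ge0.
have h2 : 0 <= w * (3 * ((y - 1 / 4) * (1 - w)) + (w ^+ 2 - 15 / 4 * w + 3)).
  apply: mulr_ge0; first exact: ltW.
  apply: addr_ge0; first by apply: mulr_ge0.
  have : 0 <= (1 - w) ^+ 2 by rewrite sqr_ge0.
  have -> : (1 - w) ^+ 2 = w ^+ 2 - 2 * w + 1 by ring.
  lra.
have e : (2 * (y + 3 / 4) - w) ^+ 2 * (y + w) - y * (2 * (y + 3 / 4)) ^+ 2 =
    w * (3 * ((y - 1 / 4) * (1 - w)) + (w ^+ 2 - 15 / 4 * w + 3)) by field.
by rewrite -subr_ge0 e.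
Qed.

(** A success multiplies the value by at most 1 - v(n+1) / (2 Sigma_n), by
    [shrink_sqrt]; on average this is a factor 1 - a / (2 n), while the growth
    of c contributes sqrt (1 + a / n), and the product is at most 1. *)
Lemma condexp_invroot_le n s : valid n s ->
  condexp v a n.+1 (invroot n.+2) s <= invroot n.+1 s.
Proof.
move=> vs; have S1 := weight_ge1 vs.
have n0 : (0 < n.+1)%N by [].
have /andP[q0 q1] := success_prob_itv v_pos weighted_sum_le a0 s n0.
have nR : 1 <= n.+1%:R :> R by rewrite ler1n.
rewrite /condexp /invroot !weight_updS mulr1 mulr0 addr0 (rising_ratioS hc n0).
have hq : success_prob v a n.+1 s = a * weight v n.+1 s / (n.+1%:R * v n.+2) by [].
have cp := c_pos n0; have vp := v_pos (isT : (0 < n.+2)%N).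
have vl := v_le1 (isT : (0 < n.+2)%N).
move: (success_prob v a n.+1 s) (weight v n.+1 s) (v n.+2) hq q0 q1 S1 vp vl => q A w hq q0 q1 A1 w0 w1.
move: (c n.+1) (n.+1%:R : R) cp nR hq => C N C0 N1 hq.
have a0' := a0; have a1' := a_lt1.
set y := A - 3 / 4.
have y4 : 1 / 4 <= y by rewrite /y; lra.
have y0 : 0 < y by lra.
have yw0 : 0 < y + w by lra.
have N0 : 0 < N by lra.
have hA : y + 3 / 4 = A by rewrite /y; ring.
have x0 : 0 <= a / N by rewrite divr_ge0// ltW.
have x1 : a / N <= 1 by rewrite ler_pdivrMr// mul1r; lra.
pose h : R := Num.sqrt (1 + a / N).
pose r : R := Num.sqrt (C / y).
have r0 : 0 <= r by exact: sqrtr_ge0.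
have h0 : 0 <= h by exact: sqrtr_ge0.
have CN : C * ((N + a) / N) = C * (1 + a / N) by field; rewrite gt_eqF.
have e0 : Num.sqrt (C * ((N + a) / N) / y) = h * r.
  rewrite CN /h /r -sqrtrM; last by lra.
  by congr Num.sqrt; ring.
have wA : 0 <= 1 - w / (2 * A).
  by rewrite subr_ge0 ler_pdivrMr; lra.
have e1 : Num.sqrt (C * ((N + a) / N) / (A + w - 3 / 4)) <= h * r * (1 - w / (2 * A)).
  have -> : A + w - 3 / 4 = y + w by rewrite /y; ring.
  rewrite -e0 -[X in _ <= _ * X]ger0_norm// -sqrtr_sqr -sqrtrM; last first.
    by rewrite CN divr_ge0 ?(ltW y0)// mulr_ge0 ?(ltW C0)//; lra.
  rewrite ler_sqrt; last first.
    by rewrite mulr_ge0 ?sqr_ge0// CN divr_ge0 ?(ltW y0)// mulr_ge0 ?(ltW C0)//; lra.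
  have := @shrink_sqrt y w y4 (introT andP (conj w0 w1)); rewrite hA => hs.
  have -> : C * ((N + a) / N) / (y + w) = C * ((N + a) / N) / y * (y / (y + w)).
    by field; rewrite ?(gt_eqF y0) ?(gt_eqF yw0) ?(gt_eqF N0).
  by rewrite ler_wpM2l// CN divr_ge0 ?(ltW y0)// mulr_ge0 ?(ltW C0)//; lra.
have h3 : h * (1 - a / N / 2) <= 1.
  rewrite -[leRHS]sqrtr1 -[X in _ * X]ger0_norm; last lra.
  rewrite -sqrtr_sqr -sqrtrM; last by lra.
  rewrite ler_sqrt//; move: (a / N) x0 x1 => x x0 x1.
  have : 0 <= x ^+ 2 * (3 - x) by rewrite mulr_ge0 ?sqr_ge0//; lra.
  rewrite (_ : (1 + x) * (1 - x / 2) ^+ 2 = 1 - x ^+ 2 * (3 - x) / 4); last by field.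
  lra.
rewrite e0 -/r.
apply: (@le_trans _ _ (q * (h * r * (1 - w / (2 * A))) + (1 - q) * (h * r))).
  by rewrite lerD2r ler_wpM2l.
have -> : q * (h * r * (1 - w / (2 * A))) + (1 - q) * (h * r) = r * (h * (1 - a / N / 2)).
  by rewrite hq; field; rewrite ?(gt_eqF w0) ?(gt_eqF N0) ?gt_eqF//; lra.
by rewrite ler_piMr.
Qed.

Lemma expect_invroot n : expect v a n (invroot n.+1) <= 2.
Proof.
elim: n => [|n IH] /=.
  rewrite /invroot /weight big_nat1 (rising_ratio1 hv) (rising_ratio1 hc) /= mulr1.
  rewrite (_ : 1 / (1 - 3 / 4) = 2 ^+ 2 :> R); last by field.
  by rewrite sqrtr_sqr ger0_norm.
apply: le_trans IH; apply: (expect_le v_pos weighted_sum_le a0) => s.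
exact: condexp_invroot_le.
Qed.

(** On M <= t^-2 the inverse root is at least t: Markov's inequality. *)
Lemma expect_mart_small n (t : R) : 0 < t ->
  expect v a n (fun s => (mart n.+1 s * t ^+ 2 <= 1)%R%:R) <= 2 / t.
Proof.
move=> t0; apply: (@le_trans _ _ (expect v a n (invroot n.+1) / t)); last first.
  by rewrite ler_pM2r ?invr_gt0// expect_invroot.
apply: (expect_markov v_pos weighted_sum_le a0 t0) => s vs; first by rewrite sqrtr_ge0.
have S1 := weight_ge1 vs; have cp := c_pos (isT : (0 < n.+1)%N).
rewrite /mart /invroot mulrAC ler_pdivrMr// mul1r => ht.
rewrite -[leLHS]ger0_norm ?(ltW t0)// -sqrtr_sqr ler_sqrt; last first.
  by rewrite divr_ge0 ?(ltW cp)//; lra.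
rewrite ler_pdivlMr; last lra.
apply: le_trans ht; rewrite mulrC ler_wpM2r ?sqr_ge0//; lra.
Qed.

(** Chebyshev's inequality, one-sided. *)
Lemma expect_increment m n (t : R) : (m <= n)%N -> 0 < t ->
  expect v a n (fun s => (t <= mart n.+1 s - mart m.+1 s)%R%:R) <= (growth v c m.+1)^-1 / t ^+ 2.
Proof.
move=> mn t0.
apply: (@le_trans _ _ (expect v a n (fun s => (mart n.+1 s - mart m.+1 s) ^+ 2) / t ^+ 2)); last first.
  by rewrite ler_pM2r ?invr_gt0 ?exprn_gt0// expect_sqdev.
apply: (expect_markov v_pos weighted_sum_le a0); first by rewrite exprn_gt0.
  by move=> s _; rewrite sqr_ge0.
by move=> s _ h; rewrite ler_pXn2r// nnegrE ?(ltW t0)// (le_trans _ h)// ltW.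
Qed.

End Moments.

(** * Almost sure convergence *)

Section AlmostSure.
Context {R : realType} (d : measure_display) (T : measurableType d).
Variables (P : probability T R) (p beta a kv kc : R) (v c : nat -> R).
Variables (b : nat -> {RV P >-> nat}) (e : nat -> {RV P >-> bool}).
Implicit Types (n m j k : nat).
Hypotheses (b1 : -1 < beta) (b0 : beta <= 0) (a0 : 0 < a) (a_lt1 : a < 1).
Hypothesis aE : a = p * (beta + 1).
Hypothesis ab1 : a <= beta + 1.
Hypotheses (hv : rising_ratio beta kv v) (hc : rising_ratio a kc c).
Hypothesis hb : forall n k : nat, (1 <= n)%N ->
  P (b n.+1 @^-1` [set k]) =
    (if (1 <= k <= n)%N then (beta + 1) / n%:R * (v k / v n.+1) else 0)%:E.
Hypothesis he : forall n : nat, (1 <= n)%N -> P (e n.+1 @^-1` [set true]) = p%:E.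
Hypothesis hindep : independent_steps P b e.

Let M n w : R := mart v c n.+1 (hist b e n w).

Lemma prob_hist_event n (B : (nat -> bool) -> bool) :
  P [set w | B (hist b e n w)] = (expect v a n (fun s => (B s)%:R))%:E.
Proof. by rewrite (law_hist_event hb he hindep) -aE. Qed.

Lemma ae_choice_in_range :
  {ae P, forall w, forall n, (1 <= n)%N -> (1 <= b n.+1 w <= n)%N}.
Proof.
suff : {ae P, forall w, forall n k, (1 <= n)%N -> b n.+1 w = k -> (1 <= k <= n)%N}.
  by apply: filterS => w h n n1; exact: (h n _ n1).
apply: ae_foralln => n; apply: ae_foralln => k.
case: (ltnP 0 n) => [n0|]; last by rewrite leqn0 => /eqP ->; apply: aeW.
have [kn|kn] := boolP (1 <= k <= n)%N; first exact: aeW.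
exists (b n.+1 @^-1` [set k]); split.
- exact: measurable_preim_b.
- by have := hb k n0; rewrite (negbTE kn).
- by move=> w /= /not_implyP[_] /not_implyP[].
Qed.

(** The event that M <= (t + 1)^-2 from some rank on is an increasing union of
    events of probability at most 2 / (t + 1). *)
Lemma ae_not_vanishing :
  {ae P, forall w, ~ (forall t, \forall n \near \oo, M n w * t.+1%:R ^+ 2 <= 1)}.
Proof.
pose A t n : set T := [set w | M n w * t.+1%:R ^+ 2 <= 1].
have mA t n : measurable (A t n).
  exact: (measurable_hist_event b e n (fun s => mart v c n.+1 s * t.+1%:R ^+ 2 <= 1)).
have PA t n : (P (A t n) <= (2 / t.+1%:R)%:E)%E.
  rewrite (prob_hist_event n (fun s => mart v c n.+1 s * t.+1%:R ^+ 2 <= 1)) lee_fin.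
  by apply: (expect_mart_small b1 b0 a0 a_lt1 ab1 hv hc); rewrite ltr0n.
pose D t m : set T := \bigcap_(n in [set n | (m <= n)%N]) A t n.
have mD t m : measurable (D t m).
  by apply: bigcap_measurable => [|n _]; [exists m => /=|exact: mA].
pose U t := \bigcup_m D t m.
have mU t : measurable (U t) by exact: bigcup_measurable.
have PU t : (P (U t) <= (2 / t.+1%:R)%:E)%E.
  have h : P \o D t @ \oo --> P (U t).
    apply: nondecreasing_cvg_mu; [exact: mD|exact: mU|].
    apply/nondecreasing_seqP => n; apply/subsetPset => w Dw k /= nk.
    by apply: Dw => /=; exact: ltnW.
  have <- := cvg_lim _ h; last exact: ereal_hausdorff.
  apply: lime_le; first by apply/cvg_ex; exists (P (U t)).
  apply: nearW => m /=; apply: le_trans (PA t m).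
  by apply: le_measure; rewrite ?inE// => w; apply => /=.
exists (\bigcap_t U t); split.
- exact: bigcapT_measurable.
- apply/eqP; rewrite eq_le measure_ge0 andbT; apply/lee_addgt0Pr => eps eps0.
  rewrite add0e.
  pose t := Num.truncn (2 / eps).
  apply: (@le_trans _ _ (P (U t))).
    apply: le_measure; rewrite ?inE//; first exact: bigcapT_measurable.
    by move=> w; apply.
  apply: (le_trans (PU t)); rewrite lee_fin ler_pdivrMr ?ltr0n//.
  rewrite mulrC -ler_pdivrMr// ltW//; exact: truncnS_gt.
- move=> w /= /contrapT h t _; have [m _ hm] := h t.
  by exists m => // n /= mn; exact: hm.
Qed.

(* A summable sequence whose tails telescope to 1 / (j + 1). *)
Let slack j : R := (j.+1%:R * j.+2%:R)^-1.

Let slackE j : slack j = j.+1%:R^-1 - j.+2%:R^-1.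
Proof.
have h : 0 < j.+1%:R :> R by rewrite ltr0n.
have h2 : 0 < j.+2%:R :> R by rewrite ltr0n.
have e2 : j.+2%:R = j.+1%:R + 1 :> R by rewrite natr1.
by rewrite /slack e2 in h2 *; field; rewrite ?gt_eqF.
Qed.

Let slack_gt0 j : 0 < slack j.
Proof. by rewrite invr_gt0 mulr_gt0 ?ltr0n. Qed.

Let sum_slack J n : \sum_(0 <= j < n) slack (j + J) <= 1 - (n + J).+1%:R^-1.
Proof.
elim: n => [|n IH]; first by rewrite big_geq// subr_ge0 invf_le1 ?ler1n ?ltr0n.
rewrite big_nat_recr//= addSn (le_trans (lerD IH (lexx _)))//.
rewrite slackE; by rewrite addrA subrK.
Qed.

(** growth (block q j) is at least of order (j + 1)^6, and slack j is of
    order (j + 1)^-2: dividing by the square of slack leaves (j + 1)^-2. *)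
Lemma growth_block_bound q : 6 <= q%:R * (a - beta) -> (0 < q)%N ->
  \forall j \near \oo, (growth v c (block q j))^-1 / slack j ^+ 2 <= 16 / (kc / kv) * slack j.
Proof.
move=> q6 q0.
have k0 : 0 < kc / kv by rewrite divr_gt0//; [case: hc|case: hv].
have [N _ HN] := growth_ge_powR b1 a0 hv hc.
near=> j.
have jN : (N <= j)%N by near: j; exact: nbhs_infty_ge.
have bj : (j.+1 <= block q j)%N.
  by rewrite -[X in (X <= _)%N]expn1 leq_pexp2l.
have := HN (block q j) (leq_trans jN (ltnW bj)) => /=.
have x1 : 1 <= j.+1%:R :> R by rewrite ler1n.
have x6 : j.+1%:R ^+ 6 <= (block q j)%:R `^ (a - beta) :> R.
  rewrite /block natrX -!powR_mulrn ?(le_trans ler01)// -powRrM.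
  exact: ler_powR.
have t0 := growth_gt0 b1 a0 hv hc (block_gt0 q j).
move: (growth v c (block q j)) ((block q j)%:R `^ (a - beta)) x6 t0 => t y x6 t0 yt.
have d0 := slack_gt0 j.
(* slack is the inverse of x (x + 1) with x = j + 1, and x + 1 <= 2 x. *)
have d3 : 1 <= 8 * j.+1%:R ^+ 6 * slack j ^+ 3.
  rewrite /slack (_ : j.+2%:R = j.+1%:R + 1); last by rewrite natr1.
  move: (j.+1%:R : R) x1 => x x1.
  have x0 : 0 < x by lra.
  have x20 : 0 < x + 1 by lra.
  have -> : 8 * x ^+ 6 * (x * (x + 1))^-1 ^+ 3 = (2 * x / (x + 1)) ^+ 3.
    by field; rewrite ?gt_eqF.
  by rewrite exprn_ege1// ler_pdivlMr//; lra.
rewrite ler_pdivrMr ?exprn_gt0// -[leLHS]mul1r ler_pdivrMr//.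
apply: (le_trans d3).
have -> : 16 / (kc / kv) * slack j * slack j ^+ 2 * t = 16 * slack j ^+ 3 / (kc / kv) * t by ring.
move: (slack j ^+ 3) (exprn_gt0 3 d0) => D D0.
apply: (@le_trans _ _ (16 * D / (kc / kv) * (kc / kv / 2 * j.+1%:R ^+ 6))).
  rewrite le_eqVlt; apply/predU1P; left; move: (kc / kv) k0 => k k0.
  by field; rewrite gt_eqF.
rewrite ler_pM2l; last by rewrite divr_gt0// mulr_gt0.
apply: le_trans yt; rewrite ler_pM2l// divr_gt0//.
Unshelve. all: by end_near. Qed.

Lemma ae_blocks : exists2 q, (0 < q)%N &
  {ae P, forall w, \forall j \near \oo,
    mart v c (block q j.+1) (hist b e (block q j.+1).-1 w) -
    mart v c (block q j) (hist b e (block q j.+1).-1 w) < slack j}.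
Proof.
have ab : 0 < a - beta by have := a0; have := b0; lra.
pose q := (Num.truncn (6 / (a - beta))).+1; exists q => //.
have q6 : 6 <= q%:R * (a - beta).
  by rewrite -ler_pdivrMr// ltW//; exact: truncnS_gt.
pose B j s := slack j <= mart v c (block q j.+1) s - mart v c (block q j) s.
pose F j : set T := [set w | B j (hist b e (block q j.+1).-1 w)].
have mF j : measurable (F j) by exact: (measurable_hist_event b e _ (B j)).
have [J _ HJ] := growth_block_bound q6 isT.
have k0 : 0 < kc / kv by rewrite divr_gt0//; [case: hc|case: hv].
have PF j : (J <= j)%N -> (P (F j) <= (16 / (kc / kv) * slack j)%:E)%E.
  move=> Jj; rewrite /F (prob_hist_event _ (B j)) lee_fin.
  apply: le_trans (HJ j Jj).
  have := @expect_increment _ _ _ _ _ _ _ b1 b0 a0 ab1 hv hc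
    (block q j).-1 (block q j.+1).-1 (slack j).
  rewrite !prednK ?block_gt0//; apply; last exact: slack_gt0.
  by rewrite -ltnS !prednK ?block_gt0// ltnW// block_lt.
have limsup0 : P (lim_sup_set (fun j => F (j + J)%N)) = 0%E.
  apply: lim_sup_set_cvg0 => //.
  apply: (@le_lt_trans _ _ (16 / (kc / kv))%:E); last exact: ltry.
  apply: lime_le; first exact: is_cvg_nneseries.
  apply: nearW => n.
  apply: (@le_trans _ _ (\sum_(0 <= j < n) (16 / (kc / kv) * slack (j + J))%:E)%E).
    by apply: lee_sum => j _; apply: PF; exact: leq_addl.
  have K0 : 0 <= 16 / (kc / kv) by rewrite divr_ge0// ltW.
  rewrite sumEFin lee_fin -mulr_sumr ler_piMr//.
  by rewrite (le_trans (sum_slack J n))// gerBl invr_ge0.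
exists (lim_sup_set (fun j => F (j + J)%N)); split => //.
- apply: bigcapT_measurable => n; exact: bigcup_measurable.
- move=> w /=; apply: contra_notP => hw.
  have [n hn] : exists n, forall j, (n <= j)%N -> ~ F (j + J)%N w.
    apply: contrapT => hn; apply: hw => n _; apply: contrapT => hj.
    by apply: hn; exists n => j nj Fj; apply: hj; exists j.
  exists (n + J)%N => // j /= nj.
  have Jj : (J <= j)%N by exact: leq_trans (leq_addl _ _) nj.
  have := hn (j - J)%N; rewrite subnK// leq_subRL// addnC => /(_ nj) /negP.
  by rewrite -ltNge.
Qed.

(** m j + 1 / (j + 1) is eventually nonincreasing and bounded below. *)
Lemma block_limit (m : nat -> R) : (forall j, 0 <= m j) ->
  (\forall j \near \oo, m j.+1 - m j < slack j) -> cvgn m.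
Proof.
move=> m0 [J _ HJ].
pose u j := m j + harmonic j.
have cu : cvgn (fun j => u (j + J)%N).
  apply: nonincreasing_is_cvgn.
    apply/nonincreasing_seqP => n; rewrite /u /harmonic/= addSn.
    have := HJ (n + J)%N (leq_addl _ _); rewrite /= slackE.
    by move: ((n + J).+1%:R^-1) ((n + J).+2%:R^-1) => A B; lra.
  exists 0 => _ [n _ <-]; rewrite /u addr_ge0//; exact: ltW (harmonic_gt0 _).
have cu' : u @ \oo --> limn (fun j => u (j + J)%N) by rewrite -(cvg_shiftn J).
apply/cvg_ex; exists (limn (fun j => u (j + J)%N) - 0).
have -> : m = u \- harmonic by apply/funext => j; rewrite /u/= addrK.
by apply: cvgB => //; exact: cvg_harmonic.
Qed.

Variable X : nat -> T -> R.
Hypothesis hX1 : forall w : T, X 1%N w = 1.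
Hypothesis hXS : forall (n : nat) (w : T), (1 <= n)%N ->
  X n.+1 w = if e n.+1 w then X (b n.+1 w) w else 0.

Lemma walk_hist w n k : (forall n, (1 <= n)%N -> (1 <= b n.+1 w <= n)%N) ->
  (0 < k <= n.+1)%N -> X k w = (hist b e n w k)%:R.
Proof.
move=> hw; elim: n k => [|n IH] k.
  by case: k => [|[|k]]// _; rewrite hX1.
move=> /andP[k0]; rewrite leq_eqVlt => /predU1P[->|kn]/=.
  rewrite hXS// /upd eqxx; have := hw n.+1 isT; case: (e n.+2 w) => //= hbn.
  exact: IH.
by rewrite /upd ltn_eqF// IH// k0.
Qed.

(** On a typical path the blocks converge, hence M converges; a limit 0 is
    excluded by [ae_not_vanishing]. *)
Lemma ae_limit : {ae P, forall w, exists2 L : R, 0 < L &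
  (\sum_(1 <= k < n.+1) v k * X k w) / c n @[n --> \oo] --> L}.
Proof.
have [q q0 hq] := ae_blocks.
apply: filterS3 ae_choice_in_range hq ae_not_vanishing => w hw hblocks hnv.
pose Mx n : R := (\sum_(1 <= k < n.+1) v k * X k w) / c n.
have martE N n : (N <= n.+1)%N -> mart v c N (hist b e n w) = Mx N.
  move=> Nn; rewrite /mart /Mx /weight; congr (_ / _); rewrite !big_nat.
  apply: eq_bigr => k /andP[k0 kN]; rewrite (@walk_hist w n k)// k0/=.
  by rewrite (leq_trans _ Nn).
have X0 k : (0 < k)%N -> 0 <= X k w.
  by move=> k0; rewrite (@walk_hist w k k)// k0/=.
have Mx0 n : (0 < n)%N -> 0 <= Mx n.
  move=> n0; rewrite -(martE n n)//.
  exact: (mart_ge0 b1 a0 hv hc).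
have /cvg_ex[/= L ML] : cvgn (fun j => Mx (block q j)).
  apply: block_limit => [j|]; first by rewrite Mx0// block_gt0.
  apply: filterS hblocks => j; rewrite !martE ?prednK ?block_gt0//.
  exact/ltnW/block_lt.
have cM : Mx @ \oo --> L by apply: (cvg_from_blocks b1 a0 a_lt1 hv hc q0 X0).
have L0 : 0 <= L.
  have <- := cvg_lim (@Rhausdorff R) cM.
  apply: limr_ge; first by apply/cvg_ex; exists L.
  by near=> n; apply: Mx0; near: n; exact: nbhs_infty_gt.
exists L => //; rewrite lt_neqAle L0 andbT; apply/eqP => L0'.
apply: hnv => t; rewrite -L0' in cM.
have t0 : 0 < (t.+1%:R : R) ^+ 2 by rewrite exprn_gt0// ltr0n.
have /cvgr0Pnorm_le/(_ (t.+1%:R ^+ 2)^-1) : Mx n.+1 @[n --> \oo] --> (0 : R).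
  by rewrite -(cvg_shiftS Mx) in cM.
rewrite invr_gt0 => /(_ t0); apply: filterS => n hn.
rewrite /M martE// -ler_pdivlMr// mul1r (le_trans _ hn)//; exact: ler_norm.
Unshelve. all: by end_near. Qed.

End AlmostSure.

(** * The limit theorem *)

Theorem mainTheorem1 (R : realType) (d : measure_display)
    (T : measurableType d) (P : probability T R) (p beta : R)
    (b : nat -> {RV P >-> nat}) (e : nat -> {RV P >-> bool})
    (X : nat -> {RV P >-> R})
    (hp : 0 < p < 1) (hbeta : -1 < beta <= 0)
    (hb : forall n k : nat, (1 <= n)%N ->
      P (b n.+1 @^-1` [set k]) =
        (if (1 <= k <= n)%N
         then (beta + 1) / n%:R * (mu beta k / mu beta n.+1)
         else 0)%:E)
    (he : forall n : nat, (1 <= n)%N -> P (e n.+1 @^-1` [set true]) = p%:E)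
    (hindep : independent_steps P b e)
    (hX1 : forall w : T, X 1%N w = 1)
    (hXS : forall (n : nat) (w : T), (1 <= n)%N ->
      X n.+1 w = if e n.+1 w then X (b n.+1 w) w else 0) :
  {ae P, forall w : T,
    0 < Minf X p beta w /\
    sim (fun n => walk X n w)
        (fun n => Cst p beta * Minf X p beta w *
                  n%:R `^ (p * (beta + 1) - beta))}.
Proof.
have /andP[p0 p1] := hp; have /andP[b1 b0] := hbeta.
have g0 : 0 < beta + 1 by lra.
pose a := p * (beta + 1).
have a0 : 0 < a by rewrite mulr_gt0.
have ab1 : a <= beta + 1 by rewrite ger_pMl// ltW.
have a_lt1 : a < 1.
  have : a < beta + 1 by rewrite gtr_pMl.
  lra.
have hv := @cn_rising_ratio R beta ltac:(lra).
have hc := @cn_rising_ratio R a ltac:(lra).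
have := ae_limit b1 b0 a0 a_lt1 erefl ab1 hv hc hb he hindep (X := fun n => X n) hX1 hXS.
apply: filterS => w [L L0 ML].
have -> : Minf X p beta w = L by exact: (cvg_lim (@Rhausdorff R) ML).
split => //.
have := walk_asymptotics b1 b0 a0 hv hc L0 ML.
rewrite /Cst -/a; congr (sim _ _); apply/funext => n; congr (_ * _ * _).
rewrite (GammaS a0) !invrK.
have Ga := Gamma_gt0 a0; have Gb := Gamma_gt0 g0.
have ab : 0 < a - beta by lra.
move: (Gamma a) (Gamma (beta + 1)) Ga => A B /gt_eqF hA.
by field; rewrite hA ?gt_eqF.
Qed.
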